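(* Let $p_1\equiv p_2\equiv1\pmod4$ be primes and $\mathbb{K}=\mathbb{Q}(\sqrt{p_1},\sqrt{2p_2},i)$, with maximal real subfield $\mathbb{K}^+=\mathbb{Q}(\sqrt{p_1},\sqrt{2p_2})$. Let $\varepsilon_1,\varepsilon_2,\varepsilon_3$ be the fundamental units of $\mathbb{Q}(\sqrt{p_1})$, $\mathbb{Q}(\sqrt{2p_2})$, $\mathbb{Q}(\sqrt{2p_1p_2})$ respectively, and write $\varepsilon_3=x+y\sqrt{2p_1p_2}$ with $x,y\in\mathbb{Z}$. Then: (1) If $N(\varepsilon_2)=N(\varepsilon_3)=-1$: (i) if $\varepsilon_1\varepsilon_2\varepsilon_3$ is a square in $\mathbb{K}^+$, then $\{\varepsilon_1,\varepsilon_2,\sqrt{\varepsilon_1\varepsilon_2\varepsilon_3}\}$ is an F.S.U. of both $\mathbb{K}^+$ and $\mathbb{K}$, and $Q_{\mathbb{K}}=1$; (ii) otherwise $\{\varepsilon_1,\varepsilon_2,\varepsilon_3\}$ is an F.S.U. of $\mathbb{K}^+$, $\{\varepsilon_1,\varepsilon_2,\sqrt{i\varepsilon_1\varepsilon_2\varepsilon_3}\}$ is an F.S.U. of $\mathbb{K}$, and $Q_{\mathbb{K}}=2$. (2) If $N(\varepsilon_2)=1$ and $N(\varepsilon_3)=-1$: $\{\varepsilon_1,\varepsilon_2,\varepsilon_3\}$ is an F.S.U. of $\mathbb{K}^+$, $\{\varepsilon_1,\sqrt{i\varepsilon_2},\varepsilon_3\}$ is an F.S.U. of $\mathbb{K}$,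 and $Q_{\mathbb{K}}=2$. (3) If $N(\varepsilon_3)=1$ and $N(\varepsilon_2)=-1$: (i) if $2p_1(x+1)$ or $2p_1(x-1)$ is a perfect square in $\mathbb{N}$, then $\{\varepsilon_1,\varepsilon_2,\sqrt{\varepsilon_3}\}$ is an F.S.U. of both $\mathbb{K}^+$ and $\mathbb{K}$, and $Q_{\mathbb{K}}=1$; (ii) otherwise $\{\varepsilon_1,\varepsilon_2,\varepsilon_3\}$ is an F.S.U. of $\mathbb{K}^+$, $\{\varepsilon_1,\varepsilon_2,\sqrt{i\varepsilon_3}\}$ is an F.S.U. of $\mathbb{K}$, and $Q_{\mathbb{K}}=2$. (4) If $N(\varepsilon_2)=N(\varepsilon_3)=1$: (i) if $2p_1(x+1)$ or $2p_1(x-1)$ is a perfect square in $\mathbb{N}$, then $\{\varepsilon_1,\varepsilon_2,\sqrt{\varepsilon_3}\}$ is an F.S.U. of $\mathbb{K}^+$, $\{\varepsilon_1,\sqrt{i\varepsilon_2},\sqrt{\varepsilon_3}\}$ is an F.S.U. of $\mathbb{K}$, and $Q_{\mathbb{K}}=2$; (ii) otherwise $\{\varepsilon_1,\varepsilon_2,\sqrt{\varepsilon_2\varepsilon_3}\}$ is an F.S.U. of $\mathbb{K}^+$, $\{\varepsilon_1,\sqrt{\varepsilon_2\varepsilon_3},\sqrt{i\varepsilon_3}\}$ is an F.S.U. of $\mathbb{K}$, and $Q_{\mathbb{K}}=2$.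
   Context: $i=\sqrt{-1}$; $N(\cdot)$ is the absolute norm (here the norm from the relevant real quadratic field to $\mathbb{Q}$). An F.S.U. (fundamental system of units) of a number field $L$ is a set of units whose images form a basis of the free abelian group $E_L/W_L$, where $E_L$ is the unit group of $\mathcal{O}_L$ and $W_L$ the group of roots of unity in $L$. For a CM-field $L$ with maximal real subfield $L^+$, Hasse's unit index is $Q_L=[E_L:W_LE_{L^+}]$. The square roots appearing are elements of the field in question (for appropriate choices of sign). *)

(* Defs.v *)
From HB Require Import structures.
From mathcomp Require Import all_boot all_order all_algebra all_field.
Set Implicit Arguments. Unset Strict Implicit. Unset Printing Implicit Defensive.
Import Order.TTheory GRing.Theory Num.Theory.
Local Open Scope ring_scope.

(* A number field is represented by its membership predicate inside algC. *)

(* Q(sqrt d), d a positive natural number (sqrtC gives the positive root). *)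
Definition inQsqrt (d : nat) (z : algC) : Prop :=
  exists a b : rat, z = ratr a + ratr b * sqrtC d%:R.

Definition qnorm_is (d : nat) (z : algC) (n : rat) : Prop :=
  exists a b : rat, z = ratr a + ratr b * sqrtC d%:R /\ a ^+ 2 - d%:R * b ^+ 2 = n.

Definition inKplus (p1 p2 : nat) (z : algC) : Prop :=
  exists a b c e : rat,
    z = ratr a + ratr b * sqrtC p1%:R + ratr c * sqrtC (2 * p2)%:R
        + ratr e * (sqrtC p1%:R * sqrtC (2 * p2)%:R).

Definition inK (p1 p2 : nat) (z : algC) : Prop :=
  exists u v, inKplus p1 p2 u /\ inKplus p1 p2 v /\ z = u + 'i * v.

Definition unitO (L : algC -> Prop) (e : algC) : Prop :=
  L e /\ e \in Aint /\ e != 0 /\ e^-1 \in Aint.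

Definition rootU (L : algC -> Prop) (z : algC) : Prop :=
  L z /\ exists n : nat, (0 < n)%N /\ z ^+ n = 1.

(* {u1,u2,u3} is a fundamental system of units of L (unit rank 3):
   the u_i are units and every unit is uniquely  zeta * u1^a u2^b u3^c
   with zeta in W_L, i.e. their images form a basis of E_L / W_L. *)
Definition FSU3 (L : algC -> Prop) (u1 u2 u3 : algC) : Prop :=
  unitO L u1 /\ unitO L u2 /\ unitO L u3 /\
  forall e, unitO L e ->
    exists! abc : int * int * int,
      exists zeta, rootU L zeta /\
        e = zeta * u1 ^ abc.1.1 * u2 ^ abc.1.2 * u3 ^ abc.2.

Definition fund_unit (d : nat) (eps : algC) : Prop :=
  unitO (inQsqrt d) eps /\ 1 < eps /\
  forall u, unitO (inQsqrt d) u -> exists k : int, u = eps ^ k \/ u = - eps ^ k.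

(* Hasse's unit index Q_L = [E_L : W_L E_{L+}] equals n: there are n
   coset representatives r_0..r_{n-1} in E_L such that every unit of L
   lies in exactly one coset r_j W_L E_{L+}. *)
Definition in_WE (L Lplus : algC -> Prop) (z : algC) : Prop :=
  exists zeta eta, rootU L zeta /\ unitO Lplus eta /\ z = zeta * eta.

Definition hasse_index (L Lplus : algC -> Prop) (n : nat) : Prop :=
  exists r : 'I_n -> algC, (forall j, unitO L (r j)) /\
    forall e, unitO L e -> exists! j : 'I_n, in_WE L Lplus (e / r j).

Definition is_sq_nat (m : int) : Prop := exists k : nat, m = (k ^ 2)%:Z.

(* Main.v *)
Require Import Defs.
From HB Require Import structures.
From mathcomp Require Import all_boot all_order all_algebra all_field.
From mathcomp Require Import zify ring lra.
Import Order.TTheory GRing.Theory Num.Theory.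
Local Open Scope ring_scope.

(** For a unit [u] of [K^+], the product of the norms of [u] to the three quadratic
    subfields is [+- u ^+ 2], so that [u ^+ 2 = e1 ^ a * e2 ^ b * e3 ^ c], and everything
    reduces to deciding which of these monomials, with exponents 0 or 1, are squares
    in [K^+]. Taking norms (with [N(e1) = -1]) fixes the parities of [a], [b], [c].
    Hilbert 90 produces a positive integer [n] such that [n] times the remaining
    monomial is a square; only the ramified primes 2, [p1], [p2] matter in [n], and
    [p1] and [2 p2] are squares in [K^+], so [n] is 1 or 2. Here [2] is not a square
    in [K^+] but [2 i] is one in [K].
    For a unit [z] of [K], the quotient [z / z^*] is a 4th root of unity, so [z] is a
    root of unity times [f] or [(1 + i) f] with [f] in [K^+], and [f ^+ 2] resp.
    [2 f ^+ 2] is a unit, to which the same analysis applies. Hence [Q_K = 2] exactly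
    when twice some unit of [K^+] is a square. *)

(** Fields are predicates on [algC], so the Galois group acts through two automorphisms [A1], [A2]
    of [algC], each flipping one of the two real square roots and fixing ['i]. No ideals are used:
    that an unramified prime cannot divide n exactly once comes from the integrality of traces, and
    z / z^* is shown to be a root of unity through norms to imaginary quadratic fields. Why e3 leads
    to subcases and e2 does not: if e2 is a square in K^+, then p1 e2 is a square in Q(sqrt (2 p2)),
    which is impossible because p1 is unramified there. In Q(sqrt (2 p1 p2)) the prime p1 ramifies,
    so p1 e3 may well be a square, and comparing rational parts and norms then yields the condition
    on 2 p1 (x +- 1). Two facts have to be derived from the hypotheses: N(e1) = -1, by a descent in
    Q(sqrt p1, sqrt 2), and p1 <> p2, from the integrality of x and y. *)

Definition nonsq (n : nat) : Prop := forall q : rat, q ^+ 2 != n%:R.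

Lemma sqr_sqrtC_nat (d : nat) : sqrtC (d%:R : algC) ^+ 2 = d%:R.
Proof. exact: sqrtCK. Qed.

Lemma sqrtC_nat_gt0 (d : nat) : nonsq d -> 0 < sqrtC (d%:R : algC).
Proof.
move=> dN; rewrite sqrtC_gt0 ltr0n lt0n; apply/eqP=> d0.
by have := dN 0; rewrite d0 expr0n eqxx.
Qed.

Lemma conj_sqrtC_nat (d : nat) : (sqrtC (d%:R : algC))^* = sqrtC d%:R.
Proof. by apply/CrealP/ger0_real; rewrite sqrtC_ge0 ler0n. Qed.

Lemma conj_ratr (a : rat) : (ratr a : algC)^* = ratr a.
Proof. exact: fmorph_rat. Qed.

Lemma ratr_natr (n : nat) : ratr (n%:R : rat) = n%:R :> algC.
Proof. exact: rmorph_nat. Qed.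

Lemma ratr_inj : injective (ratr : rat -> algC).
Proof. exact: fmorph_inj. Qed.

Lemma quadratic_eq0 (d : nat) (a b : rat) : nonsq d ->
  ratr a + ratr b * sqrtC d%:R = 0 :> algC -> a = 0 /\ b = 0.
Proof.
move=> dN e; have b0 : b = 0.
  apply/eqP/negPn/negP=> b0; have := dN (a / b); case/eqP; apply: ratr_inj.
  rewrite rmorphXn rmorph_nat -(sqr_sqrtC_nat d) rmorphM /= fmorphV.
  have rb0 : (ratr b : algC) != 0 by rewrite fmorph_eq0.
  have -> : ratr a = - (ratr b * sqrtC (d%:R : algC)).
    by apply/eqP; rewrite -addr_eq0; apply/eqP.
  by field.
split=> //; apply: ratr_inj; move: e; rewrite b0 !rmorph0 mul0r addr0; exact.
Qed.

(** * Automorphisms of [algC] that change the sign of one square root *)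

Section Fadjoin.
Variables (F : fieldType) (L : fieldExtType F) (K : {subfield L}) (x : L).
Hypothesis Kx2 : x ^+ 2 \in K.

(** Horner evaluation stays in this form: (a + b x) x + c = (b x^2 + c) + a x, and x^2 lies in
    [K]. *)
Lemma Fadjoin_sqrtP v : v \in <<K; x>>%VS ->
  exists a b : L, [/\ a \in K, b \in K & v = a + b * x].
Proof.
case/Fadjoin_polyP => p; move: v; elim/poly_ind: p => [|p c IHp] v Kp ->.
  by exists 0, 0; rewrite rpred0 horner0 mul0r addr0.
have cK : c \in K by have := polyOverP Kp 0; rewrite coefD coefMX coefC /= add0r.
have Kp' : p \is a polyOver K.
  apply/polyOverP=> i; have := polyOverP Kp i.+1.
  by rewrite coefD coefMX coefC /= addr0.
have [a [b [Ka Kb e]]] := IHp _ Kp' erefl.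
exists (b * x ^+ 2 + c), a; split=> //; first exact: rpredD (rpredM Kb Kx2) cK.
by rewrite hornerD hornerM hornerX hornerC e; ring.
Qed.

(** The minimal polynomial divides X^2 - x^2 and has degree at least 2, so they coincide. This is
    what allows x to be sent to -x over [K]. *)
Lemma root_minPoly_sqrtN : x \notin K -> root (minPoly K x) (- x).
Proof.
move=> Kx; have mX : 'X^2 - (x ^+ 2)%:P \is monic by rewrite monicXnsubC.
have dv : minPoly K x %| 'X^2 - (x ^+ 2)%:P.
  apply: minPoly_dvdp; first by rewrite rpredB ?rpredX ?polyOverX ?polyOverC.
  by rewrite /root !hornerE subrr.
have sz : size (minPoly K x) = 3.
  apply/eqP; rewrite eqn_leq; apply/andP; split.
    by apply: leq_trans (dvdp_leq (monic_neq0 mX) dv) _; rewrite size_XnsubC.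
  by rewrite size_minPoly ltnS ltn_neqAle eq_sym adjoin_deg_eq1 Kx.
have /eqP -> : minPoly K x == 'X^2 - (x ^+ 2)%:P.
  rewrite -eqp_monic ?monic_minPoly //.
  by rewrite -dvdp_size_eqp // sz size_XnsubC.
by rewrite /root !hornerE sqrrN subrr.
Qed.
End Fadjoin.

Lemma sqrt_flip_aut (d1 d2 : nat) : nonsq d1 -> nonsq d2 -> nonsq (d1 * d2) ->
  exists nu : {rmorphism algC -> algC},
    [/\ nu (sqrtC d1%:R) = - sqrtC d1%:R, nu (sqrtC d2%:R) = sqrtC d2%:R
      & nu 'i = 'i].
Proof.
move=> N1 N2 N12; set s1 := sqrtC d1%:R; set s2 := sqrtC d2%:R.
(* The root whose sign changes comes last, so that it is adjoined to the field [E] generated by the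
   two elements to be fixed. *)
have [Qs [QsC [s Ds genQs]]] := num_field_exists [:: s2; 'i; s1].
case: s Ds genQs => [|x2 [|xi [|x1 [|]]]] // [D2 Di D1] genQs.
have inj := fmorph_inj QsC.
pose E0 := <<1; x2>>%AS; pose E := <<E0; xi>>%AS.
have x2E0 : x2 ^+ 2 \in 1%VS.
  by have -> : x2 ^+ 2 = d2%:R; [apply: inj; rewrite rmorphXn rmorph_nat /= D2 sqr_sqrtC_nat | rewrite rpred_nat].
have xiE : xi ^+ 2 \in E0.
  by have -> : xi ^+ 2 = -1; [apply: inj; rewrite rmorphXn rmorphN1 /= Di sqrCi | rewrite rpredN1].
have x1E : x1 ^+ 2 \in E.
  by have -> : x1 ^+ 2 = d1%:R; [apply: inj; rewrite rmorphXn rmorph_nat /= D1 sqr_sqrtC_nat | rewrite rpred_nat].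
have E0P z : z \in E0 -> exists a b : rat, QsC z = ratr a + ratr b * s2.
  case/(Fadjoin_sqrtP _ _ _ _ x2E0) => a [b [/vlineP[a' ->] /vlineP[b' ->] ->]].
  exists a', b'; rewrite rmorphD rmorphM /= D2.
  by rewrite !rmorphZ_num !rmorph1 !mulr1.
(* If [s1] were in Q(s2, i), complex conjugation would remove the ['i] part because [s1] is real;
   squaring s1 = a + b s2 then makes d1 or d1 d2 a rational square. *)
have x1nE : x1 \notin E.
  apply/negP => /(Fadjoin_sqrtP _ _ _ _ xiE)[u [v [/E0P[a [b eu]] /E0P[c [e ev]] Dx1]]].
  have e1 : s1 = ratr a + ratr b * s2 + (ratr c + ratr e * s2) * 'i.
    by rewrite -D1 Dx1 rmorphD rmorphM /= eu ev Di.
  have e1' : s1 = ratr a + ratr b * s2 - (ratr c + ratr e * s2) * 'i.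
    have := congr1 (fun z : algC => z^*) e1; rewrite /s1 /s2 /=.
    by rewrite !(fmorph_rat, rmorphD, rmorphM) /= !conj_sqrtC_nat conjCi => ->; ring.
  have {}e1 : s1 = ratr a + ratr b * s2.
    have two0 : 2 != 0 :> algC by rewrite pnatr_eq0.
    apply: (mulfI two0); rewrite mulr_natl mulr2n {1}e1 e1'; ring.
  have [||h1 h2] := @quadratic_eq0 d2 (a ^+ 2 + d2%:R * b ^+ 2 - d1%:R) (2 * a * b) => //.
    rewrite !(rmorphD, rmorphN, rmorphM, rmorphXn, rmorph_nat) /=.
    rewrite -/s2 -(sqr_sqrtC_nat d1) -(sqr_sqrtC_nat d2) -/s1 -/s2 e1; ring.
  move/eqP: h2; rewrite !mulf_eq0 pnatr_eq0 /=; case/orP=> /eqP h0.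
    have := N12 (d2%:R * b); rewrite natrM.
    by move: h1; rewrite h0 => h1; case/eqP; rewrite (_ : d1%:R = d2%:R * b ^+ 2) ; [ring|lra].
  by have := N1 a; move: h1; rewrite h0 => h1; case/eqP; lra.
pose phi := kHomExtend E \1 x1 (- x1).
have homE : kHom E E (\1%VF : 'End(Qs)) by rewrite kHom1.
have rt : root (map_poly \1%VF (minPoly E x1)) (- x1).
  rewrite map_poly_id; first exact: root_minPoly_sqrtN.
  by move=> z _; rewrite id_lfunE.
have homphi : kHom E <<E; x1>> phi := kHomExtendP (subvv _) homE rt.
have full : <<E; x1>>%VS = {:Qs}%VS.
  by rewrite -genQs !adjoin_cons adjoin_nil; apply/esym; apply: subfield_closed.
have homphi1 : kHom 1 {:Qs} phi.
  by rewrite -full; apply: kHomSl homphi; apply: sub1v.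
have phiM := elimT kHom_monoid_morphism homphi1.
pose phiA := GRing.isZmodMorphism.Build _ _ phi (raddfB phi).
pose phiMM := GRing.isMonoidMorphism.Build _ _ phi phiM.
pose phiRM : {rmorphism Qs -> Qs} := HB.pack (fun_of_lfun phi) phiA phiMM.
have [nu Dnu] := extend_algC_subfield_aut QsC phiRM.
have idE z : z \in E -> phi z = z.
  by case/(kHomP_tmp): homphi => + _; apply.
exists nu; split.
- by rewrite -D1 -Dnu /= (kHomExtend_val homE rt) rmorphN.
- rewrite -D2 -Dnu /= idE //; apply: (subvP (subv_adjoin _ _)); exact: memv_adjoin.
- by rewrite -Di -Dnu /= idE //; exact: memv_adjoin.
Qed.

(** * Algebraic integers and units *)

Lemma Aint_sqrt (z : algC) : z ^+ 2 \in Aint -> z \in Aint.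
Proof.
move=> Az; apply: (@root_monic_Aint (minCpoly (z ^+ 2) \Po 'X^2)).
- by rewrite /root horner_comp !hornerE; exact: root_minCpoly.
- by rewrite monicE lead_coef_comp ?size_polyXn // lead_coefXn expr1n mulr1 -monicE minCpoly_monic.
- by rewrite polyOver_comp // rpredX // polyOverX.
Qed.

(** The part of [unitO] that does not mention a field, so that closure properties and passage to
    conjugates are independent of [L]. *)
Definition algunit (z : algC) : Prop := [/\ z \in Aint, z != 0 & z^-1 \in Aint].

Lemma algunitM z w : algunit z -> algunit w -> algunit (z * w).
Proof.
by move=> [az nz aVz] [aw nw aVw]; split; rewrite ?mulf_neq0 ?invfM ?rpredM.
Qed.

Lemma algunitV z : algunit z -> algunit z^-1.
Proof. by move=> [az nz aVz]; split; rewrite ?invr_eq0 ?invrK. Qed.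

Lemma algunit1 : algunit 1.
Proof. by split; rewrite ?oner_eq0 ?invr1 ?Aint1. Qed.

Lemma algunitX z n : algunit z -> algunit (z ^+ n).
Proof.
move=> uz; elim: n => [|n IHn]; first exact: algunit1.
by rewrite exprS; apply: algunitM.
Qed.

Lemma algunitXz z (n : int) : algunit z -> algunit (z ^ n).
Proof.
move=> uz; case: n => n; first exact: algunitX.
by rewrite NegzE -exprz_inv; apply: algunitX; apply: algunitV.
Qed.

Lemma algunitN z : algunit z -> algunit (- z).
Proof. by move=> [az nz aVz]; split; rewrite ?oppr_eq0 ?invrN ?rpredN. Qed.

Lemma algunit_sqrt z : algunit (z ^+ 2) -> algunit z.
Proof.
move=> [az nz aVz]; split; last by apply: Aint_sqrt; rewrite exprVn.
  exact: Aint_sqrt.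
by move: nz; rewrite expf_eq0.
Qed.

Lemma algunit_aut (nu : {rmorphism algC -> algC}) z : algunit z -> algunit (nu z).
Proof. by case=> az nz aVz; split; rewrite ?fmorph_eq0 -?fmorphV ?Aint_aut. Qed.

Lemma algunit_i : algunit 'i.
Proof. by apply: algunit_sqrt; rewrite sqrCi; apply/algunitN/algunit1. Qed.

Lemma unitOE L z : unitO L z <-> L z /\ algunit z.
Proof. by split=> [[Lz [az [nz aVz]]]|[Lz [az nz aVz]]]. Qed.

Lemma Aint_ratr (a : rat) : ratr a \in Aint -> exists n : int, a = n%:~R.
Proof.
move=> aA; have : (ratr a : algC) \in Num.int by apply: Cint_rat_Aint; rewrite ?Crat_rat.
case/intrP=> n e; exists n; apply: ratr_inj; by rewrite e rmorph_int.
Qed.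

Lemma algunit_ratr (a : rat) : algunit (ratr a) -> a = 1 \/ a = -1.
Proof.
case=> /Aint_ratr [n ->]; rewrite -fmorphV fmorph_eq0 => n0 /Aint_ratr [m e].
have nm : n * m = 1.
  by apply: (@intr_inj rat); rewrite intrM -e mulfV.
have : `|n|%N = 1%N.
  by move/(congr1 absz)/eqP: nm; rewrite abszM muln_eq1 => /andP[/eqP].
by case: n {n0 e nm} => [] n /= h; [left|right]; [|case: n h => //]; rewrite ?h.
Qed.

Lemma rmorphXzf (nu : {rmorphism algC -> algC}) z (n : int) : nu (z ^ n) = nu z ^ n.
Proof. by case: n => n; rewrite ?NegzE /= ?fmorphV rmorphXn. Qed.

Lemma sqr_eq (R : idomainType) (x y : R) : x ^+ 2 = y ^+ 2 -> x = y \/ x = - y.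
Proof. by move/eqP; rewrite eqf_sqr => /orP[] /eqP; [left|right]. Qed.

Lemma int_parity (a : int) : exists k : int, a = 2 * k \/ a = 2 * k + 1.
Proof. by exists (divz a 2); lia. Qed.

Lemma N1Xz_even (k : int) : (-1 : algC) ^ (2 * k) = 1.
Proof. by rewrite -exprz_exp -exprnP sqrrN expr1n exp1rz. Qed.

Lemma N1Xz_odd (k : int) : (-1 : algC) ^ (2 * k + 1) = -1.
Proof. by rewrite expfzDr ?oppr_eq0 ?oner_eq0 // N1Xz_even mul1r expr1z. Qed.

Section Biquadratic.
Variables d1 d2 : nat.
Hypotheses (N1 : nonsq d1) (N2 : nonsq d2) (N12 : nonsq (d1 * d2)).
Local Notation s1 := (sqrtC (d1%:R : algC)).
Local Notation s2 := (sqrtC (d2%:R : algC)).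
Variables A1 A2 : {rmorphism algC -> algC}.
Hypotheses (A1s1 : A1 s1 = - s1) (A1s2 : A1 s2 = s2) (A1i : A1 'i = 'i).
Hypotheses (A2s1 : A2 s1 = s1) (A2s2 : A2 s2 = - s2) (A2i : A2 'i = 'i).

(** * The fields Q(sqrt d1, sqrt d2) and Q(sqrt d1, sqrt d2, i) *)

(** With d1 = p1 and d2 = 2 p2 this is [inKplus]. General radicands are kept because the auxiliary
    fields Q(sqrt p, sqrt 2) and Q(sqrt (2 p2), sqrt 2) are used too. *)
Definition biquad (z : algC) : Prop :=
  exists a b c e : rat, z = ratr a + ratr b * s1 + ratr c * s2 + ratr e * (s1 * s2).
Local Notation Kp := biquad.

Lemma sqrtCM12 : sqrtC (d1 * d2)%:R = s1 * s2 :> algC.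
Proof. by rewrite natrM sqrtCM ?nnegrE ?ler0n. Qed.

Lemma s1_neq0 : s1 != 0. Proof. exact: lt0r_neq0 (sqrtC_nat_gt0 _ N1). Qed.
Lemma s2_neq0 : s2 != 0. Proof. exact: lt0r_neq0 (sqrtC_nat_gt0 _ N2). Qed.

Lemma biquad_rat a : Kp (ratr a).
Proof. by exists a, 0, 0, 0; rewrite !rmorph0; ring. Qed.

Lemma biquad_nat n : Kp n%:R.
Proof. by rewrite -ratr_natr; exact: biquad_rat. Qed.

Lemma biquad1 : Kp 1. Proof. exact: (biquad_nat 1). Qed.

Lemma biquad_s1 : Kp s1.
Proof. by exists 0, 1, 0, 0; rewrite !rmorph0 rmorph1; ring. Qed.

Lemma biquad_s2 : Kp s2.
Proof. by exists 0, 0, 1, 0; rewrite !rmorph0 rmorph1; ring. Qed.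

Lemma biquadD z w : Kp z -> Kp w -> Kp (z + w).
Proof.
move=> [a [b [c [e ->]]]] [a' [b' [c' [e' ->]]]].
by exists (a + a'), (b + b'), (c + c'), (e + e'); rewrite !rmorphD /=; ring.
Qed.

Lemma biquadN z : Kp z -> Kp (- z).
Proof.
move=> [a [b [c [e ->]]]].
by exists (- a), (- b), (- c), (- e); rewrite !rmorphN /=; ring.
Qed.

Lemma biquadB z w : Kp z -> Kp w -> Kp (z - w).
Proof. by move=> Kz Kw; apply: biquadD => //; apply: biquadN. Qed.

Lemma biquadM z w : Kp z -> Kp w -> Kp (z * w).
Proof.
move=> [a [b [c [e ->]]]] [a' [b' [c' [e' ->]]]].
exists (a * a' + d1%:R * b * b' + d2%:R * c * c' + d1%:R * d2%:R * e * e'),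
  (a * b' + b * a' + d2%:R * (c * e' + e * c')),
  (a * c' + c * a' + d1%:R * (b * e' + e * b')),
  (a * e' + e * a' + b * c' + c * b').
rewrite !(rmorphD, rmorphM, rmorph_nat) /=.
have h1 := sqr_sqrtC_nat d1; have h2 := sqr_sqrtC_nat d2.
by move: s1 s2 h1 h2 => t1 t2 <- <-; ring.
Qed.

Lemma biquadX z n : Kp z -> Kp (z ^+ n).
Proof.
move=> Kz; elim: n => [|n IHn]; first exact: biquad1.
by rewrite exprS; apply: biquadM.
Qed.

Lemma biquad_A1 z : Kp z -> Kp (A1 z).
Proof.
move=> [a [b [c [e ->]]]]; exists a, (- b), c, (- e).
by rewrite !(fmorph_rat, rmorphD, rmorphM, rmorphN) /= A1s1 A1s2; ring.
Qed.

Lemma biquad_A2 z : Kp z -> Kp (A2 z).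
Proof.
move=> [a [b [c [e ->]]]]; exists a, b, (- c), (- e).
by rewrite !(fmorph_rat, rmorphD, rmorphM, rmorphN) /= A2s1 A2s2; ring.
Qed.

Lemma biquad_A1K z : Kp z -> A1 (A1 z) = z.
Proof.
move=> [a [b [c [e ->]]]].
by rewrite !(fmorph_rat, rmorphD, rmorphM) /= !A1s1 !A1s2 rmorphN A1s1; ring.
Qed.

Lemma biquad_A2K z : Kp z -> A2 (A2 z) = z.
Proof.
move=> [a [b [c [e ->]]]].
by rewrite !(fmorph_rat, rmorphD, rmorphM) /= !A2s1 !A2s2 rmorphN A2s2; ring.
Qed.

Lemma biquad_A12 z : Kp z -> A2 (A1 z) = A1 (A2 z).
Proof.
move=> [a [b [c [e ->]]]].
rewrite !(fmorph_rat, rmorphD, rmorphM) /= !A2s1 !A2s2 !A1s1 !A1s2 !rmorphN.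
by rewrite ?A1s2 ?A2s1 ?A1s1 ?A2s2; ring.
Qed.

Lemma biquad_conj z : Kp z -> z^* = z.
Proof.
move=> [a [b [c [e ->]]]].
by rewrite !(fmorph_rat, rmorphD, rmorphM) /= !conj_sqrtC_nat.
Qed.

Lemma biquad_real z : Kp z -> z \is Num.real.
Proof. by move/biquad_conj=> h; apply/CrealP. Qed.

Lemma biquad_sqr_gt0 z : Kp z -> z != 0 -> 0 < z ^+ 2.
Proof. by move=> Kz z0; rewrite real_exprn_even_gt0 ?biquad_real //= z0. Qed.

Let half (x : algC) : x + x = 0 -> x = 0.
Proof. by move/eqP; rewrite -mulr2n mulrn_eq0 => /eqP. Qed.

Lemma biquad_fix2 z : Kp z -> A2 z = z -> inQsqrt d1 z.
Proof.
move=> [a [b [c [e ->]]]]; rewrite !(fmorph_rat, rmorphD, rmorphM) /= A2s1 A2s2 => h.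
exists a, b; suff h0 : ratr c * s2 + ratr e * (s1 * s2) = 0.
  by apply/eqP; rewrite -subr_eq0 -h0; apply/eqP; ring.
by apply: half; move/esym/eqP: h; rewrite -subr_eq0 => /eqP <-; ring.
Qed.

Lemma biquad_fix1 z : Kp z -> A1 z = z -> inQsqrt d2 z.
Proof.
move=> [a [b [c [e ->]]]]; rewrite !(fmorph_rat, rmorphD, rmorphM) /= A1s1 A1s2 => h.
exists a, c; suff h0 : ratr b * s1 + ratr e * (s1 * s2) = 0.
  by apply/eqP; rewrite -subr_eq0 -h0; apply/eqP; ring.
by apply: half; move/esym/eqP: h; rewrite -subr_eq0 => /eqP <-; ring.
Qed.

Lemma biquad_fix12 z : Kp z -> A1 (A2 z) = z -> inQsqrt (d1 * d2) z.
Proof.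
move=> [a [b [c [e ->]]]]; rewrite !(fmorph_rat, rmorphD, rmorphM) /= A2s1 A2s2.
rewrite rmorphN A1s1 A1s2 => h.
exists a, e; rewrite sqrtCM12; suff h0 : ratr b * s1 + ratr c * s2 = 0.
  by apply/eqP; rewrite -subr_eq0 -h0; apply/eqP; ring.
by apply: half; move/esym/eqP: h; rewrite -subr_eq0 => /eqP <-; ring.
Qed.

Lemma inQsqrt_biquad1 z : inQsqrt d1 z -> Kp z.
Proof. by move=> [a [b ->]]; exists a, b, 0, 0; rewrite !rmorph0; ring. Qed.

Lemma inQsqrt_biquad2 z : inQsqrt d2 z -> Kp z.
Proof. by move=> [a [b ->]]; exists a, 0, b, 0; rewrite !rmorph0; ring. Qed.

Lemma inQsqrt_biquad12 z : inQsqrt (d1 * d2) z -> Kp z.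
Proof. by move=> [a [b ->]]; exists a, 0, 0, b; rewrite !rmorph0 sqrtCM12; ring. Qed.

Lemma inQsqrt_A1 z : inQsqrt d2 z -> A1 z = z.
Proof. by move=> [a [b ->]]; rewrite !(fmorph_rat, rmorphD, rmorphM) /= A1s2. Qed.

Lemma inQsqrt_A2 z : inQsqrt d1 z -> A2 z = z.
Proof. by move=> [a [b ->]]; rewrite !(fmorph_rat, rmorphD, rmorphM) /= A2s1. Qed.

Lemma inQsqrt_A12 z : inQsqrt (d1 * d2) z -> A1 (A2 z) = z.
Proof.
move=> [a [b ->]]; rewrite sqrtCM12 !(fmorph_rat, rmorphD, rmorphM) /=.
by rewrite A2s1 A2s2 rmorphN A1s1 A1s2; ring.
Qed.

Lemma biquad_fix z : Kp z -> A1 z = z -> A2 z = z -> exists a : rat, z = ratr a.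
Proof.
move=> Kz h1 /(biquad_fix2 _ Kz)[a [b e]]; exists a.
move: h1; rewrite e !(fmorph_rat, rmorphD, rmorphM) /= A1s1 => h.
suff -> : ratr b * s1 = 0 by rewrite addr0.
by apply: half; move/esym/eqP: h; rewrite -subr_eq0 => /eqP <-; ring.
Qed.

Lemma biquadV z : Kp z -> Kp z^-1.
Proof.
move=> Kz; have [->|z0] := eqVneq z 0; first by rewrite invr0; exact: (biquad_nat 0).
(* The product of the other three conjugates: [z * w] is the absolute norm, hence rational. *)
pose w := A1 z * A2 z * A1 (A2 z).
have Kw : Kp w by do !apply: biquadM => //; do ?[apply: biquad_A1|apply: biquad_A2].
have w0 : w != 0 by rewrite !mulf_neq0 ?fmorph_eq0.
have [|||a ea] := @biquad_fix (z * w); first exact: biquadM.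
- rewrite /w !rmorphM /= biquad_A1K // (biquad_A1K (A2 z)) ?biquad_A1 //; last exact: biquad_A2.
  by ring.
- rewrite /w !rmorphM /= biquad_A2K // !biquad_A12 //; last exact: biquad_A2.
  by rewrite (biquad_A2K z) //; ring.
have eV : ratr a^-1 = (z * w)^-1 :> algC by rewrite ea; exact: (fmorphV ratr).
have -> : z^-1 = w * ratr a^-1 by rewrite eV; field; rewrite z0 w0.
by apply: biquadM => //; exact: biquad_rat.
Qed.

Lemma biquadXz z (n : int) : Kp z -> Kp (z ^ n).
Proof.
move=> Kz; case: n => n; first exact: biquadX.
by rewrite NegzE -exprz_inv; apply: biquadX; apply: biquadV.
Qed.

Lemma biquad_div z w : Kp z -> Kp w -> Kp (z / w).
Proof. by move=> Kz Kw; apply: biquadM => //; apply: biquadV. Qed.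

(** As f^2 is rational, [A1] and [A2] act on f by signs. Multiplying f by the one of 1, s1, s2, s1
    s2 with the same signs gives an element fixed by both, hence rational. *)
Lemma biquad_sqrt_nat n f : Kp f -> f ^+ 2 = n%:R ->
  exists q : rat, [\/ q ^+ 2 = n%:R, d1%:R * q ^+ 2 = n%:R, d2%:R * q ^+ 2 = n%:R
                    | (d1 * d2)%:R * q ^+ 2 = n%:R].
Proof.
move=> Kf ef.
have key (m : nat) g : Kp g -> g != 0 -> g ^+ 2 = m%:R ->
    A1 (f * g) = f * g -> A2 (f * g) = f * g -> exists q : rat, m%:R * q ^+ 2 = n%:R.
  move=> Kg g0 eg h1 h2; have [|a ea] := @biquad_fix (f * g) _ h1 h2.
    exact: biquadM.
  have m0 : (m%:R : rat) != 0.
    rewrite pnatr_eq0; apply: contra_neq g0 => m0; apply/eqP.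
    by move/eqP: eg; rewrite m0 expf_eq0.
  exists (a / m%:R); have -> : m%:R * (a / m%:R) ^+ 2 = a ^+ 2 / m%:R by field.
  apply: ratr_inj; rewrite rmorphM rmorphXn fmorphV !rmorph_nat /= -ea exprMn.
  by rewrite ef -eg mulfK // expf_neq0.
have [h1|h1] : A1 f = f \/ A1 f = - f by apply: sqr_eq; rewrite -rmorphXn ef rmorph_nat.
all: have [h2|h2] : A2 f = f \/ A2 f = - f by apply: sqr_eq; rewrite -rmorphXn ef rmorph_nat.
- have [|||||q eq] // := key 1%N 1; rewrite ?mulr1 ?oner_eq0 ?expr1n //; first exact: biquad1.
  by exists q; constructor 1; rewrite -eq mul1r.
- have [|||||q eq] // := key d2 s2; rewrite ?s2_neq0 ?sqrtCK ?rmorphM //=.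
  + exact: biquad_s2.
  + by rewrite h1 A1s2.
  + by rewrite h2 A2s2 mulrNN.
  by exists q; constructor 3.
- have [|||||q eq] // := key d1 s1; rewrite ?s1_neq0 ?sqrtCK ?rmorphM //=.
  + exact: biquad_s1.
  + by rewrite h1 A1s1 mulrNN.
  + by rewrite h2 A2s1.
  by exists q; constructor 2.
have [|||||q eq] // := key (d1 * d2)%N (s1 * s2).
- by apply: biquadM; [exact: biquad_s1 | exact: biquad_s2].
- by rewrite mulf_neq0 ?s1_neq0 ?s2_neq0.
- by rewrite exprMn !sqrtCK natrM.
- by rewrite !rmorphM /= h1 A1s1 A1s2; ring.
- by rewrite !rmorphM /= h2 A2s1 A2s2; ring.
by exists q; constructor 4.
Qed.

Lemma inQsqrt_norm1 z : inQsqrt d1 z -> exists a : rat, z * A1 z = ratr a.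
Proof.
move=> Qz; have Kz := inQsqrt_biquad1 _ Qz; apply: biquad_fix.
- by apply: biquadM => //; exact: biquad_A1.
- by rewrite rmorphM /= biquad_A1K // mulrC.
- by rewrite rmorphM /= biquad_A12 // inQsqrt_A2.
Qed.

Lemma inQsqrt_norm2 z : inQsqrt d2 z -> exists a : rat, z * A2 z = ratr a.
Proof.
move=> Qz; have Kz := inQsqrt_biquad2 _ Qz; apply: biquad_fix.
- by apply: biquadM => //; exact: biquad_A2.
- by rewrite rmorphM /= -biquad_A12 // inQsqrt_A1.
- by rewrite rmorphM /= biquad_A2K // mulrC.
Qed.

(** [A1] and [A2] restrict to the same conjugation of Q(sqrt (d1 d2)), so [A1] can be used for its
    norm. *)
Lemma inQsqrt_norm12 z : inQsqrt (d1 * d2) z -> exists a : rat, z * A1 z = ratr a.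
Proof.
move=> Qz; have Kz := inQsqrt_biquad12 _ Qz; have h := inQsqrt_A12 _ Qz.
have h2 : A2 z = A1 z by rewrite -{2}h biquad_A1K //; exact: biquad_A2.
apply: biquad_fix.
- by apply: biquadM => //; exact: biquad_A1.
- by rewrite rmorphM /= biquad_A1K // mulrC.
- by rewrite rmorphM /= biquad_A12 // h h2 mulrC.
Qed.

Lemma pm1_of_norm z w : (exists a : rat, z * w = ratr a) -> algunit z -> algunit w ->
  z * w = 1 \/ z * w = -1.
Proof.
move=> [a ea] uz uw; have := algunitM _ _ uz uw; rewrite ea => /algunit_ratr [] ->.
  by left; rewrite rmorph1.
by right; rewrite rmorphN1.
Qed.

Definition trace4 (z : algC) : algC := z + A1 z + A2 z + A1 (A2 z).

Lemma trace4_rat z : Kp z -> exists a : rat, trace4 z = ratr a.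
Proof.
move=> Kz; have K1 := biquad_A1 _ Kz; have K2 := biquad_A2 _ Kz.
apply: biquad_fix; first by do !apply: biquadD => //; exact: biquad_A1.
  by rewrite /trace4 !rmorphD /= !biquad_A1K //; ring.
rewrite /trace4 !rmorphD /= (biquad_A12 (A2 z)) // !biquad_A2K // biquad_A12 //.
by ring.
Qed.

(** The traces of f, s1 f, s2 f, s1 s2 f are 4, 4 d1, 4 d2, 4 d1 d2 times the coordinates of f; the
    factor 4 d1 d2 keeps the coefficients integral. *)
Lemma trace4_expand f : Kp f ->
  (4 * d1 * d2)%:R * f = d1%:R * d2%:R * trace4 f + d2%:R * s1 * trace4 (s1 * f)
    + d1%:R * s2 * trace4 (s2 * f) + s1 * s2 * trace4 (s1 * s2 * f).
Proof.
move=> Kf; rewrite /trace4 !rmorphM /= !(A2s1, A2s2, rmorphN, A1s1, A1s2) !natrM.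
have h1 := sqr_sqrtC_nat d1; have h2 := sqr_sqrtC_nat d2.
by move: s1 s2 h1 h2 => t1 t2 <- <-; ring.
Qed.

Lemma Aint_sqrtC d : sqrtC (d%:R : algC) \in Aint.
Proof. by apply: Aint_sqrt; rewrite sqrtCK Aint_Cnat ?natr_nat. Qed.

(* A prime not dividing the discriminant does not ramify in Q(s1, s2). If
   [q] divides [r] and [r u] is a square [f ^+ 2], then [f] divides all its
   conjugates, so [f * Tr(w f)] lies in [r Aint] for all integral [w]. *)
Lemma unramified_dvd (q r : nat) u f : prime q -> ~~ (q %| 2 * d1 * d2)%N ->
  algunit u -> Kp f -> r%:R * u = f ^+ 2 -> (q %| r)%N -> (q ^ 2 %| r)%N.
Proof.
move=> q_pr q_ndvd uu Kf ef qr; have [->|r_gt0] := posnP r; first by rewrite dvdn0.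
have r0 : (r%:R : algC) != 0 by rewrite pnatr_eq0 -lt0n.
have [u_int u0 uV_int] := uu.
have f0 : f != 0.
  have f20 : f ^+ 2 != 0 by rewrite -ef mulf_neq0.
  by move: f20; rewrite expf_eq0.
(* The square of this quotient is nu(u) / u, since r is rational. *)
have ratio (nu : {rmorphism algC -> algC}) : nu f / f \in Aint.
  apply: Aint_sqrt; rewrite expr_div_n -rmorphXn -ef rmorphM rmorph_nat /=.
  by rewrite -mulf_div divff // mul1r rpredM ?Aint_aut.
have tr w : Kp w -> w \in Aint -> exists k : int, trace4 (w * f) = q%:R * k%:~R.
  move=> Kw w_int; have [a ea] := trace4_rat _ (biquadM _ _ Kw Kf).
  pose X := w + A1 w * (A1 f / f) + A2 w * (A2 f / f) + A1 (A2 w) * (A1 (A2 f) / f).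
  have X_int : X \in Aint.
    have term (nu : {rmorphism algC -> algC}) : nu w * (nu f / f) \in Aint.
      by apply: rpredM; [rewrite Aint_aut | exact: ratio].
    by rewrite !rpredD ?term //; exact: (term (A1 \o A2)).
  have eX : trace4 (w * f) = f * X by rewrite /trace4 /X !rmorphM /=; field.
  have [n en] : exists n : int, a = n%:~R.
    apply: Aint_ratr; rewrite -ea eX rpredM //; apply: Aint_sqrt.
    by rewrite -ef rpredM // Aint_Cnat ?natr_nat.
  have [m em] : exists m : int, a ^+ 2 / r%:R = m%:~R.
    apply: Aint_ratr; rewrite rmorphM fmorphV rmorphXn rmorph_nat /= -ea eX.
    have -> : (f * X) ^+ 2 / r%:R = u * X ^+ 2 by rewrite exprMn -ef; field.
    by rewrite rpredM // rpredX.
  (* (f X)^2 / r = u X^2 is integral, so r, and with it the prime q, divides the square of the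
     trace; hence q divides the trace. *)
  have dn : (n ^+ 2 = r%:Z * m)%R.
    apply: (@intr_inj rat); rewrite rmorphXn rmorphM /= -en -em -pmulrn.
    by rewrite mulrC divfK // pnatr_eq0 -lt0n.
  have /dvdzP[k ek] : (q %| n)%Z.
    have : (q %| `|n| ^ 2)%N by rewrite -abszX dn abszM dvdn_mulr.
    by rewrite Euclid_dvdX // => /andP[].
  by exists k; rewrite ea en ek rmorph_int intrM mulrC -pmulrn.
have [k0 h0] := tr 1 biquad1 Aint1; rewrite mul1r in h0.
have [k1 h1] := tr s1 biquad_s1 (Aint_sqrtC d1).
have [k2 h2] := tr s2 biquad_s2 (Aint_sqrtC d2).
have [||k3 h3] := tr (s1 * s2); first by apply: biquadM; [exact: biquad_s1|exact: biquad_s2].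
  by rewrite rpredM ?Aint_sqrtC.
have := trace4_expand f Kf; rewrite h0 h1 h2 h3.
pose Y := d1%:R * d2%:R * k0%:~R + d2%:R * s1 * k1%:~R + d1%:R * s2 * k2%:~R
  + s1 * s2 * k3%:~R : algC.
have Y_int : Y \in Aint.
  by rewrite !rpredD ?rpredM ?Aint_sqrtC ?Aint_int // Aint_Cnat ?natr_nat.
move=> h; have {}h : (4 * d1 * d2)%:R * f = q%:R * Y by rewrite h /Y; ring.
have q0 : (q%:R : algC) != 0 by rewrite pnatr_eq0 -lt0n prime_gt0.
have qr0 : (q%:R : rat) != 0 by rewrite pnatr_eq0 -lt0n prime_gt0.
(* This rational number equals Y^2 / u, so it is an integer; q is prime to 4 d1 d2, which leaves q^2
   dividing r. *)
pose a : rat := ((4 * d1 * d2) ^ 2 * r)%:R / q%:R ^+ 2.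
have [m em] : exists m : int, a = m%:~R.
  apply: Aint_ratr; rewrite /a rmorphM fmorphV rmorphXn !rmorph_nat /=.
  have -> : ((4 * d1 * d2) ^ 2 * r)%:R / q%:R ^+ 2 = Y ^+ 2 * u^-1 :> algC.
    have -> : ((4 * d1 * d2) ^ 2 * r)%:R = ((4 * d1 * d2)%:R * f) ^+ 2 / u :> algC.
      by rewrite exprMn -ef natrM natrX; field.
    by rewrite h; field; rewrite u0 q0.
  by rewrite rpredM // rpredX.
have : (q ^ 2 %| (4 * d1 * d2) ^ 2 * r)%N.
  apply/dvdnP; exists `|m|%N.
  have dm : ((4 * d1 * d2) ^ 2 * r)%:Z = m * (q ^ 2)%:Z.
    apply: (@intr_inj rat); rewrite [in RHS]intrM -em /a -!pmulrn.
    by rewrite (natrX _ q) divfK // expf_neq0.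
  by have := congr1 absz dm; rewrite abszM.
rewrite Gauss_dvdr // coprimeXl // coprimeXr // prime_coprime //.
have -> : (4 * d1 * d2 = 2 * (2 * d1 * d2))%N by rewrite -[4%N]/(2 * 2)%N -!mulnA.
rewrite Euclid_dvdM // negb_or q_ndvd andbT; apply: contra q_ndvd => q2.
by rewrite -mulnA dvdn_mulr.
Qed.

(** * Adjoining ['i] *)

Definition biquadi (z : algC) : Prop := exists u v, Kp u /\ Kp v /\ z = u + 'i * v.
Local Notation KK := biquadi.

Lemma biquad_biquadi z : Kp z -> KK z.
Proof.
by move=> Kz; exists z, 0; split=> //; split; [exact: (biquad_nat 0)|rewrite mulr0 addr0].
Qed.

Lemma biquadi1 : KK 1. Proof. exact/biquad_biquadi/biquad1. Qed.

Lemma biquadi_i : KK 'i.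
Proof.
exists 0, 1; split; first exact: (biquad_nat 0).
by split; [exact: biquad1|rewrite mulr1 add0r].
Qed.

Lemma biquadiM z w : KK z -> KK w -> KK (z * w).
Proof.
move=> [u [v [Ku [Kv ->]]]] [u' [v' [Ku' [Kv' ->]]]].
exists (u * u' - v * v'), (u * v' + v * u'); split; [|split].
- by apply: biquadB; apply: biquadM.
- by apply: biquadD; apply: biquadM.
have -> : u * u' - v * v' = u * u' + 'i ^+ 2 * (v * v') by rewrite sqrCi; ring.
by ring.
Qed.

Lemma biquadi_conj z : KK z -> KK z^*.
Proof.
move=> [u [v [Ku [Kv ->]]]]; exists u, (- v); split=> //; split; first exact: biquadN.
by rewrite rmorphD rmorphM /= conjCi !biquad_conj //; ring.
Qed.

Lemma biquadiV z : KK z -> KK z^-1.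
Proof.
move=> Kz; have [->|z0] := eqVneq z 0; first by rewrite invr0; apply/biquad_biquadi/(biquad_nat 0).
have K' := biquadi_conj _ Kz.
have -> : z^-1 = z^* * (z * z^*)^-1 by rewrite invfM mulrCA mulfV ?mulr1 ?conjC_eq0.
apply: biquadiM => //; apply/biquad_biquadi/biquadV.
case: Kz => u [v [Ku [Kv ->]]].
have -> : (u + 'i * v) * (u + 'i * v)^* = u * u + v * v.
  rewrite rmorphD rmorphM /= conjCi !biquad_conj //.
  have -> : v * v = - ('i ^+ 2 * (v * v)) by rewrite sqrCi; ring.
  by ring.
by apply: biquadD; apply: biquadM.
Qed.

Lemma biquadi_fix_conj z : KK z -> z^* = z -> Kp z.
Proof.
move=> [u [v [Ku [Kv ->]]]]; rewrite rmorphD rmorphM /= conjCi !biquad_conj // => h.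
suff -> : u + 'i * v = u by [].
have h0 : 'i * v = 0.
  by apply: half; move/esym/eqP: h; rewrite -subr_eq0 => /eqP <-; ring.
by rewrite h0 addr0.
Qed.

Lemma biquadi_inj u v u' v' : Kp u -> Kp v -> Kp u' -> Kp v' ->
  u + 'i * v = u' + 'i * v' -> u = u' /\ v = v'.
Proof.
move=> Ku Kv Ku' Kv' h; have hc := congr1 (fun z : algC => z^*) h.
rewrite /= !rmorphD !rmorphM /= conjCi !biquad_conj // in hc.
have h0 : u - u' = 0.
  apply: half; have -> : u - u' + (u - u') = (u + 'i * v) + (u + - 'i * v) - u' - u' by ring.
  by rewrite h hc; ring.
have e0 : u = u' by apply/eqP; rewrite -subr_eq0 h0.
split=> //; move: h; rewrite e0 => /addrI /mulfI; apply; exact: neq0Ci.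
Qed.

(** The common properties of the three sign changes [A1], [A2], [A1 \o A2], so that one argument in
    [norm1_exp8] serves all three relative norms. *)
Definition good_aut (s : {rmorphism algC -> algC}) : Prop :=
  [/\ forall z, Kp z -> Kp (s z), forall z, Kp z -> s (s z) = z & s 'i = 'i].

Lemma good_A1 : good_aut A1.
Proof. by split=> [z /biquad_A1|z /biquad_A1K|]. Qed.

Lemma good_A2 : good_aut A2.
Proof. by split=> [z /biquad_A2|z /biquad_A2K|]. Qed.

Lemma good_A12 : good_aut (A1 \o A2).
Proof.
split=> [z Kz|z Kz|] /=; last by rewrite A2i A1i.
  by apply/biquad_A1/biquad_A2.
by rewrite (biquad_A12 (A2 z)) ?biquad_A2K ?biquad_A1K //; exact: biquad_A2.
Qed.

Lemma good_biquadi s z : good_aut s -> KK z -> KK (s z).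
Proof.
move=> [sK _ si] [u [v [Ku [Kv ->]]]]; exists (s u), (s v).
by split; [exact: sK|split; [exact: sK|rewrite rmorphD rmorphM /= si]].
Qed.

Lemma good_invol s z : good_aut s -> KK z -> s (s z) = z.
Proof.
move=> [sK ss si] [u [v [Ku [Kv ->]]]].
by rewrite !rmorphD !rmorphM /= !si !ss.
Qed.

Lemma good_conj s z : good_aut s -> KK z -> s z^* = (s z)^*.
Proof.
move=> [sK ss si] [u [v [Ku [Kv ->]]]]; rewrite !rmorphD !rmorphM /= si !conjCi rmorphN si.
by rewrite !biquad_conj //; apply: sK.
Qed.
Lemma expr4 (x : algC) : x ^+ 4 = (x ^+ 2) ^+ 2.
Proof. by rewrite -exprM. Qed.

(** Traces give integers n = 2 a and m = 2 b with n^2 + m^2 = 4, so one of them vanishes and the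
    number is 1, -1, i or -i. *)
Lemma gaussian_norm1 (a b : rat) : ratr a + 'i * ratr b \in Aint -> a ^+ 2 + b ^+ 2 = 1 ->
  (ratr a + 'i * ratr b) ^+ 4 = 1 :> algC.
Proof.
set z := _ + _ => z_int e.
have zc_int : z^* \in Aint by rewrite Aint_aut.
have zc : z^* = ratr a - 'i * ratr b.
  by rewrite /z rmorphD rmorphM /= conjCi !conj_ratr mulNr.
have i_int : 'i \in Aint by case: algunit_i.
have [n en] : exists n : int, 2 * a = n%:~R.
  apply: Aint_ratr; have -> : ratr (2 * a) = z + z^* :> algC.
    by rewrite zc /z rmorphM rmorph_nat /=; ring.
  by rewrite rpredD.
have [m em] : exists m : int, 2 * b = m%:~R.
  apply: Aint_ratr; have -> : ratr (2 * b) = - ('i * (z - z^*)) :> algC.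
    rewrite zc /z rmorphM rmorph_nat /=.
    have -> : - ('i * (ratr a + 'i * ratr b - (ratr a - 'i * ratr b))) = - 'i ^+ 2 * (2 * ratr b) :> algC by ring.
    by rewrite sqrCi; ring.
  by rewrite rpredN rpredM // rpredB.
have h : n * n + m * m = 4.
  apply: (@intr_inj rat); rewrite intrD !intrM -en -em.
  have -> : 2 * a * (2 * a) + 2 * b * (2 * b) = 4 * (a ^+ 2 + b ^+ 2) by ring.
  by rewrite e mulr1.
have [[n0 m2]|[n2 m0]] : (n = 0 /\ m * m = 4) \/ (n * n = 4 /\ m = 0).
  have nb : -2 <= n <= 2 by nia.
  have mb : -2 <= m <= 2 by nia.
  have : n = -2 \/ n = -1 \/ n = 0 \/ n = 1 \/ n = 2 by lia.
  have : m = -2 \/ m = -1 \/ m = 0 \/ m = 1 \/ m = 2 by lia.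
  by move=> [|[|[|[|]]]] em' [|[|[|[|]]]] en'; subst n m; lia.
- have a0 : a = 0 by move: en; rewrite n0 => /eqP; rewrite mulf_eq0 => /orP[] // /eqP.
  have b1 : b ^+ 2 = 1 by rewrite -e a0 expr0n add0r.
  rewrite /z a0 rmorph0 add0r exprMn !expr4 -rmorphXn b1.
  by rewrite rmorph1 expr1n mulr1 sqrCi sqrrN expr1n.
have b0 : b = 0 by move: em; rewrite m0 => /eqP; rewrite mulf_eq0 => /orP[] // /eqP.
have a1 : a ^+ 2 = 1 by rewrite -e b0 expr0n addr0.
by rewrite /z b0 rmorph0 mulr0 addr0 expr4 -rmorphXn a1 rmorph1 expr1n.
Qed.

(* The trace [n] is 0, +-1 or +-2; the value 0 would make [d] a square, the
   values +-1 would make [3 d] a square. *)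
Lemma imag_quadratic_norm1 (d : nat) (a b : rat) (n : int) : nonsq d -> nonsq (3 * d) ->
  2 * a = n%:~R -> a ^+ 2 + d%:R * b ^+ 2 = 1 -> a ^+ 2 = 1 /\ b = 0.
Proof.
move=> dN d3N en e.
have h : n%:~R ^+ 2 + d%:R * (2 * b) ^+ 2 = 4 :> rat.
  have -> : n%:~R ^+ 2 + d%:R * (2 * b) ^+ 2 = 4 * (a ^+ 2 + d%:R * b ^+ 2) by rewrite -en; ring.
  by rewrite e mulr1.
have db_ge0 : 0 <= d%:R * (2 * b) ^+ 2 by rewrite mulr_ge0 ?ler0n ?sqr_ge0.
have n4 : (n * n <= 4)%R.
  have : n%:~R ^+ 2 <= 4 :> rat by rewrite -h lerDl.
  by rewrite expr2 -intrM (_ : 4 = 4%:~R :> rat) // ler_int.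
have nb : n = -2 \/ n = -1 \/ n = 0 \/ n = 1 \/ n = 2 by nia.
have n1 : n * n = 1 -> False.
  move=> n1; have n1' : n%:~R ^+ 2 = 1 :> rat by rewrite expr2 -intrM n1.
  case/eqP: (d3N (d%:R * (2 * b))); rewrite exprMn natrM.
  have -> : d%:R ^+ 2 * (2 * b) ^+ 2 = d%:R * (d%:R * (2 * b) ^+ 2) by ring.
  have -> : d%:R * (2 * b) ^+ 2 = 3 by move: h; rewrite n1'; lra.
  by ring.
have n0 : n = 0 -> False.
  move=> n0; case/eqP: (dN (d%:R * b)); rewrite exprMn expr2 -mulrA.
  by move: h; rewrite n0 expr0n add0r => h; have -> : d%:R * b ^+ 2 = 1; [lra|rewrite mulr1].
have a2 : a ^+ 2 = 1.
  have : n%:~R ^+ 2 = 4 :> rat.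
    by case: nb => [->|[h1|[h1|[h1|->]]]] //; case: n1; rewrite h1.
  by rewrite -en => h2; nra.
split=> //; move: e; rewrite a2 => e.
have : d%:R * b ^+ 2 = 0 by lra.
move/eqP; rewrite mulf_eq0 expf_eq0 /= => /orP[/eqP d0|/eqP //].
by have := dN 0; rewrite d0 expr0n eqxx.
Qed.

(** * Units of absolute value 1 in K *)

Section Norm1.
Variables (s t : {rmorphism algC -> algC}) (g : algC) (d : nat).
Hypotheses (gs : good_aut s) (gt : good_aut t).
Hypotheses (dN : nonsq d) (d3N : nonsq (3 * d)).
Hypothesis st : forall z, Kp z -> s (t z) = t (s z).
Hypothesis fixst : forall z, Kp z -> s z = z -> t z = z -> exists a : rat, z = ratr a.
Hypotheses (Kg : Kp g) (g2 : g ^+ 2 = d%:R) (sg : s g = - g) (tg : t g = g).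

(* The square of [w = z * t z] is the product of its norms to [Q(i)] and to
   [Q(sqrt (- d))], which are units of absolute value 1 there. *)
Lemma norm1_exp8 z : KK z -> algunit z -> z * z^* = 1 -> (z * t z) ^+ 8 = 1.
Proof.
move=> Kz uz z1; set w := z * t z.
have Kw : KK w by apply: biquadiM => //; exact: good_biquadi.
have tw : t w = w by rewrite rmorphM /= good_invol // mulrC.
have uw : algunit w by apply: algunitM => //; exact: algunit_aut.
have w1 : w * w^* = 1.
  rewrite rmorphM /= -(good_conj t) // mulrACA z1 mul1r.
  by rewrite -rmorphM z1 rmorph1.
clearbody w.
have stK x : KK x -> s (t x) = t (s x).
  have [sK _ si] := gs; have [tK _ ti] := gt.
  by move=> [u [v [Ku [Kv ->]]]]; rewrite !rmorphD !rmorphM /= ti si ti !st.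
have Kwc := biquadi_conj _ Kw.
have Ksw := good_biquadi _ _ gs Kw.
(* [w] lies in Q(g, i), being fixed by [t]. This is its norm to Q(i), a Gaussian integer of absolute
   value 1. *)
have alpha4 : (w * s w) ^+ 4 = 1.
  have Ka : KK (w * s w) by exact: biquadiM.
  have ua : algunit (w * s w) by apply: algunitM => //; exact: algunit_aut.
  have sa : s (w * s w) = w * s w by rewrite rmorphM /= good_invol // mulrC.
  have ta : t (w * s w) = w * s w by rewrite rmorphM /= -stK // tw.
  have a1 : (w * s w) * (w * s w)^* = 1.
    by rewrite rmorphM /= -(good_conj s) // mulrACA w1 mul1r -rmorphM w1 rmorph1.
  case: Ka ua sa ta a1 => u [v [Ku [Kv ->]]] [a_int _ _].
  have [sK _ si] := gs; have [tK _ ti] := gt.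
  rewrite !rmorphD !rmorphM /= si ti.
  move=> /(biquadi_inj _ _ _ _ (sK _ Ku) (sK _ Kv) Ku Kv)[su sv].
  move=> /(biquadi_inj _ _ _ _ (tK _ Ku) (tK _ Kv) Ku Kv)[tu tv].
  have [a ea] := fixst u Ku su tu; have [b eb] := fixst v Kv sv tv.
  rewrite conjCi !biquad_conj // ea eb => h; apply: gaussian_norm1; first by rewrite -ea -eb.
  apply: ratr_inj; rewrite rmorph1 -h rmorphD !rmorphXn /=.
  have -> : ratr b ^+ 2 = - ('i ^+ 2 * ratr b ^+ 2) :> algC by rewrite sqrCi; ring.
  by ring.
(* The norm to Q(sqrt (- d)): it is fixed by [t] and by [s] composed with conjugation, so its real
   part is rational and its imaginary part is a rational multiple of [g]. *)
have beta2 : (w * s w^*) ^+ 2 = 1.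
  have Kb : KK (w * s w^*) by apply: biquadiM => //; exact: good_biquadi.
  have b_int : w * s w^* \in Aint.
    by case: uw => w_int _ _; rewrite rpredM // !Aint_aut.
  have bc : (w * s w^*)^* = s (w * s w^*).
    by rewrite !rmorphM /= good_invol // -(good_conj s) // conjCK mulrC.
  have tb : t (w * s w^*) = w * s w^* by rewrite rmorphM /= -stK // good_conj // tw.
  have b1 : (w * s w^*) * (w * s w^*)^* = 1.
    rewrite bc rmorphM /= good_invol // [s w * _]mulrC mulrACA w1 mul1r.
    by rewrite -rmorphM [w^* * w]mulrC w1 rmorph1.
  case: Kb b_int bc tb b1 => u [v [Ku [Kv ->]]] b_int.
  have [sK _ si] := gs; have [tK _ ti] := gt.
  rewrite !rmorphD !rmorphM /= si ti conjCi !biquad_conj //.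
  rewrite (_ : u + - 'i * v = u + 'i * - v); last by ring.
  move=> /(biquadi_inj _ _ _ _ Ku (biquadN _ Kv) (sK _ Ku) (sK _ Kv))[su sv].
  move=> /(biquadi_inj _ _ _ _ (tK _ Ku) (tK _ Kv) Ku Kv)[tu tv].
  have [a ea] := fixst u Ku (esym su) tu.
  have [||c ec] := fixst (v * g) (biquadM _ _ Kv Kg); rewrite ?rmorphM ?tv ?tg //=.
    by rewrite -sv sg mulrNN.
  have d0 : (d%:R : algC) != 0.
    by rewrite pnatr_eq0; apply/eqP=> d0; have := dN 0; rewrite d0 expr0n eqxx.
  have ev : v ^+ 2 = d%:R * ratr (c / d%:R) ^+ 2.
    rewrite rmorphM fmorphV rmorph_nat /= -ec.
    have -> : d%:R * (v * g / d%:R) ^+ 2 = v ^+ 2 * g ^+ 2 / d%:R by field.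
    by rewrite g2 mulfK.
  have [n en] : exists n : int, 2 * a = n%:~R.
    apply: Aint_ratr; have -> : ratr (2 * a) = (u + 'i * v) + (u + 'i * v)^* :> algC.
      by rewrite rmorphD !rmorphM /= rmorph_nat conjCi !biquad_conj // ea; ring.
    by rewrite rpredD // Aint_aut.
  move=> h; have [|a2 c0] := @imag_quadratic_norm1 d a (c / d%:R) n dN d3N en.
    have E : ratr (a ^+ 2 + d%:R * (c / d%:R) ^+ 2) = u ^+ 2 + v ^+ 2.
      rewrite ev ea -!rmorphXn -[in RHS](ratr_natr d) -rmorphM -rmorphD; exact.
    apply: ratr_inj; rewrite E rmorph1 -h.
    have -> : v ^+ 2 = - ('i ^+ 2 * v ^+ 2) by rewrite sqrCi; ring.
    by ring.
  move: ev; rewrite c0 rmorph0 expr0n mulr0 => /eqP; rewrite expf_eq0 /= => /eqP ->.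
  by rewrite mulr0 addr0 ea -rmorphXn a2 rmorph1.
have -> : w ^+ 8 = ((w * s w) * (w * s w^*)) ^+ 4.
  have -> : (w * s w) * (w * s w^*) = w ^+ 2.
    by rewrite mulrACA -rmorphM w1 rmorph1 mulr1.
  by rewrite -exprM.
by rewrite exprMn alpha4 expr4 beta2 expr1n mulr1.
Qed.
End Norm1.

Section NoSqrt2.
Hypothesis no_sqrt2 : forall f, Kp f -> f ^+ 2 <> 2.
Hypotheses (T1 : nonsq (3 * d1)) (T2 : nonsq (3 * d2)) (T12 : nonsq (3 * (d1 * d2))).

(** A primitive 8th root of unity would bring sqrt 2 into K^+: if z = u + i v has square i or -i,
    then u^2 = v^2 and 2 u v = +-1, which forces (2 u)^2 = 2. *)
Lemma biquadi_exp4N z : KK z -> z ^+ 4 != -1.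
Proof.
move=> [u [v [Ku [Kv ->]]]]; apply/eqP => h.
have {}h : u ^+ 2 - v ^+ 2 = 0 /\ (2 * u * v = 1 \/ 2 * u * v = -1).
  have K1 : Kp (u ^+ 2 - v ^+ 2) by apply: biquadB; exact: biquadX.
  have K2 : Kp (2 * u * v) by apply: biquadM => //; apply: biquadM => //; exact: biquad_nat.
  have e2 : (u + 'i * v) ^+ 2 = (u ^+ 2 - v ^+ 2) + 'i * (2 * u * v).
    have -> : u ^+ 2 - v ^+ 2 = u ^+ 2 + 'i ^+ 2 * v ^+ 2 by rewrite sqrCi mulN1r.
    by ring.
  have : (u + 'i * v) ^+ 2 = 'i \/ (u + 'i * v) ^+ 2 = - 'i.
    by apply: sqr_eq; rewrite -exprM h sqrCi.
  have K0 : Kp 0 by exact: (biquad_nat 0).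
  rewrite e2 => -[] E.
    have [|-> ->] := biquadi_inj _ _ 0 1 K1 K2 K0 biquad1; last by split=> //; left.
    by rewrite E mulr1 add0r.
  have [|-> ->] := biquadi_inj _ _ 0 (-1) K1 K2 K0 (biquadN _ biquad1); last by split=> //; right.
  by rewrite E mulrN1 add0r.
case: h => /eqP; rewrite subr_eq0 => /eqP uv h.
have e4 : (2 * u * v) ^+ 2 = 1 by case: h => ->; rewrite ?sqrrN expr1n.
have : (2 * u ^+ 2) ^+ 2 = 1 ^+ 2.
  have -> : (2 * u ^+ 2) ^+ 2 = 4 * u ^+ 2 * u ^+ 2 by ring.
  by rewrite {2}uv expr1n; apply: etrans e4; ring.
have u2_ge0 : 0 <= 2 * u ^+ 2 by rewrite mulr_ge0 ?ler0n // real_exprn_even_ge0 ?biquad_real.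
case/sqr_eq => E.
  apply: (no_sqrt2 (2 * u)); first by apply: biquadM => //; exact: biquad_nat.
  have -> : (2 * u) ^+ 2 = 2 * (2 * u ^+ 2) by ring.
  by rewrite E mulr1.
by move: u2_ge0; rewrite E lerNr oppr0 ler10.
Qed.

(** The three relative norms combine through z^2 * A1 (z * A1 (A2 z)) = (z * A1 z) * (z * A2 z),
    which gives z^16 = 1. As K has no primitive 8th root of unity, the exponent drops to 8 and then
    to 4. *)
Lemma biquadi_norm1_exp4 z : KK z -> algunit z -> z * z^* = 1 -> z ^+ 4 = 1.
Proof.
move=> Kz uz z1.
have h1 : (z * A1 z) ^+ 8 = 1.
  apply: (@norm1_exp8 A2 A1 s2 d2) => //; try exact: good_A1; try exact: good_A2.
  - by move=> x /biquad_A12.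
  - by move=> x Kx h2 h1; exact: biquad_fix.
  - exact: biquad_s2.
  - exact: sqrtCK.
have h2 : (z * A2 z) ^+ 8 = 1.
  apply: (@norm1_exp8 A1 A2 s1 d1) => //; try exact: good_A1; try exact: good_A2.
  - by move=> x /biquad_A12.
  - by move=> x Kx h1' h2; exact: biquad_fix.
  - exact: biquad_s1.
  - exact: sqrtCK.
have h3 : (z * A1 (A2 z)) ^+ 8 = 1.
  apply: (@norm1_exp8 A1 (A1 \o A2) (s1 * s2) (d1 * d2)) => //; try exact: good_A1; try exact: good_A12.
  - by move=> x Kx /=; rewrite -(biquad_A12 x).
  - by move=> x Kx h1' h12 /=; apply: biquad_fix => //; rewrite -{2}h12 /= -biquad_A12 // h1'.
  - by apply: biquadM; [exact: biquad_s1 | exact: biquad_s2].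
  - by rewrite exprMn !sqrtCK natrM.
  - by rewrite rmorphM /= A1s1 A1s2 mulNr.
  - by rewrite /= !rmorphM /= A2s1 A2s2 rmorphN A1s1 A1s2 mulrNN.
have [_ z0 _] := uz.
have z16 : z ^+ 16 = 1.
  have e : z ^+ 2 * A1 (z * A1 (A2 z)) = (z * A1 z) * (z * A2 z).
    have KA2 := good_biquadi _ _ good_A2 Kz.
    by rewrite rmorphM /= (good_invol _ _ good_A1 KA2); ring.
  have := congr1 (fun x => x ^+ 8) e.
  by rewrite /= [in LHS]exprMn [in RHS]exprMn h1 h2 -rmorphXn h3 rmorph1 !mulr1 -exprM.
have step (x : algC) : x ^+ 2 = 1 -> x != -1 -> x = 1.
  move=> h nx; have [//|h'] : x = 1 \/ x = -1 by apply: sqr_eq; rewrite h expr1n.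
  by rewrite h' eqxx in nx.
have z8 : z ^+ 8 = 1.
  apply: step; first by rewrite -exprM.
  by rewrite (exprM z 2 4); apply: biquadi_exp4N; rewrite expr2; exact: biquadiM.
apply: step; first by rewrite -exprM.
exact: biquadi_exp4N.
Qed.

(** The squared modulus of [(1 + 'i) ^+ b]. *)
Definition two_pow (b : bool) : nat := if b then 2 else 1.

Lemma one_plus_i_neq0 : 1 + 'i != 0 :> algC.
Proof.
apply/eqP => /eqP; rewrite addrC addr_eq0 => /eqP h.
have := sqrCi algC; rewrite h sqrrN expr1n => /eqP.
by rewrite -subr_eq0 opprK -mulr2n pnatr_eq0.
Qed.

(* [z / z^*] is a 4th root of unity; dividing [z] by a suitable
   [zeta * (1 + i) ^+ b] makes it real. *)
Lemma biquadi_unit_form z : KK z -> algunit z ->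
  exists b zeta f, [/\ KK zeta, zeta ^+ 4 = 1, Kp f, z = zeta * (1 + 'i) ^+ (b : bool) * f
    & algunit ((two_pow b)%:R * f ^+ 2)].
Proof.
move=> Kz uz; have [z_int z0 zV_int] := uz.
have zc0 : z^* != 0 by rewrite conjC_eq0.
have h4 : (z / z^*) ^+ 4 = 1.
  apply: biquadi_norm1_exp4.
  - by apply: biquadiM => //; apply: biquadiV; exact: biquadi_conj.
  - by apply: algunitM => //; apply: algunitV; exact: (algunit_aut (Num.conj_op : {rmorphism algC -> algC})).
  - by rewrite rmorphM fmorphV /= conjCK; field; rewrite z0 zc0.
have KV b : KK ((1 + 'i) ^+ (b : bool)).
  case: b; rewrite ?expr0 ?expr1; last exact: biquadi1.
  by exists 1, 1; rewrite mulr1; do ?split; exact: biquad1.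
(* The quotient of 1 + i by its conjugate is i. So once z / z^* is written as zeta^2 i^b, the
   quotient of z by zeta (1 + i)^b is fixed by conjugation. *)
have finish (b : bool) zeta : KK zeta -> zeta ^+ 4 = 1 -> zeta * zeta^* = 1 ->
    z / z^* = zeta ^+ 2 * 'i ^+ b ->
    exists b zeta f, [/\ KK zeta, zeta ^+ 4 = 1, Kp f, z = zeta * (1 + 'i) ^+ (b : bool) * f
    & algunit ((two_pow b)%:R * f ^+ 2)].
  move=> Kzeta zeta4 zeta1 e.
  have zeta0 : zeta != 0 by apply/eqP=> h; move/eqP: zeta1; rewrite h mul0r eq_sym oner_eq0.
  have i0 := one_plus_i_neq0.
  pose f := z / (zeta * (1 + 'i) ^+ b).
  have den0 : zeta * (1 + 'i) ^+ b != 0 by rewrite mulf_neq0 // expf_neq0.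
  have ez : z = zeta * (1 + 'i) ^+ b * f by rewrite /f mulrC divfK.
  exists b, zeta, f; split=> //.
    apply: biquadi_fix_conj; first by apply: biquadiM => //; apply/biquadiV/biquadiM.
    have zetaV : zeta^* = zeta^-1 by apply: (mulfI zeta0); rewrite zeta1 mulfV.
    have ez' : z^* = z / (zeta ^+ 2 * 'i ^+ b).
      by rewrite -e invfM invrK mulrA mulfV // mul1r.
    rewrite /f rmorphM fmorphV rmorphM rmorphXn rmorphD rmorph1 /= conjCi zetaV ez'.
    case: (b); rewrite ?expr0 ?expr1; last by field.
    have ni0 : 1 - 'i != 0 :> algC.
      by have := one_plus_i_neq0; rewrite -conjC_eq0 rmorphD rmorph1 /= conjCi.
    have -> : 1 + 'i = 'i * (1 - 'i) :> algC by rewrite mulrBr mulr1 -expr2 sqrCi opprK addrC.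
    by field; rewrite ni0 neq0Ci zeta0.
  have -> : (two_pow b)%:R * f ^+ 2 = z ^+ 2 * (zeta ^+ 2 * 'i ^+ b)^-1.
    rewrite ez; have ip2 : (1 + 'i) ^+ 2 = 2 * 'i :> algC.
      have -> : (1 + 'i) ^+ 2 = 1 + 'i ^+ 2 + 2 * 'i :> algC by ring.
      by rewrite sqrCi subrr add0r.
    rewrite !exprMn -exprM mulnC exprM.
    case: (b); rewrite /two_pow ?expr0 ?expr1 ?expr1n ?ip2; field; rewrite ?neq0Ci zeta0 //.
  apply: algunitM; first exact: algunitX.
  apply: algunitV; apply: algunitM; last exact: algunitX algunit_i.
  by apply: algunitX; split=> //;
     [apply: (@Aint_unity_root 4)|apply: (@Aint_unity_root 4)] => //; apply/unity_rootP; rewrite ?exprVn zeta4 ?invr1.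
have i2 := sqrCi algC.
have i4 : 'i ^+ 4 = 1 :> algC by rewrite expr4 sqrCi sqrrN expr1n.
have ii : 'i * 'i^* = 1 :> algC by rewrite conjCi mulrN -expr2 sqrCi opprK.
have h2 : (z / z^*) ^+ 2 = 1 \/ (z / z^*) ^+ 2 = -1.
  by apply: sqr_eq; rewrite -exprM h4 expr1n.
case: h2 => h2.
  have [h|h] : z / z^* = 1 \/ z / z^* = -1 by apply: sqr_eq; rewrite h2 expr1n.
  - by apply: (finish false 1); rewrite ?rmorph1 ?mulr1 ?expr1n //; exact: biquadi1.
  - by apply: (finish false 'i) => //; [exact: biquadi_i | rewrite h expr0 mulr1 sqrCi].
have [h|h] : z / z^* = 'i \/ z / z^* = - 'i by apply: sqr_eq; rewrite h2 sqrCi.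
- by apply: (finish true 1); rewrite ?rmorph1 ?mulr1 ?expr1n ?mul1r ?expr1 //; exact: biquadi1.
- by apply: (finish true 'i) => //; [exact: biquadi_i | rewrite h expr1 sqrCi mulN1r].
Qed.
(** * Units and fundamental units of the quadratic subfields *)

Section Fundamental.
Variables e1 e2 e3 n1 n2 n3 : algC.
Hypotheses (F1 : fund_unit d1 e1) (F2 : fund_unit d2 e2) (F3 : fund_unit (d1 * d2) e3).
Hypotheses (en1 : e1 * A1 e1 = n1) (en2 : e2 * A2 e2 = n2) (en3 : e3 * A1 e3 = n3).

Lemma Ke1 : Kp e1. Proof. by case: F1 => -[/inQsqrt_biquad1]. Qed.
Lemma Ke2 : Kp e2. Proof. by case: F2 => -[/inQsqrt_biquad2]. Qed.
Lemma Ke3 : Kp e3. Proof. by case: F3 => -[/inQsqrt_biquad12]. Qed.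
Lemma ue1 : algunit e1. Proof. by case: F1 => /unitOE[]. Qed.
Lemma ue2 : algunit e2. Proof. by case: F2 => /unitOE[]. Qed.
Lemma ue3 : algunit e3. Proof. by case: F3 => /unitOE[]. Qed.
Lemma e1_gt1 : 1 < e1. Proof. by case: F1 => _ []. Qed.
Lemma e2_gt1 : 1 < e2. Proof. by case: F2 => _ []. Qed.
Lemma e3_gt1 : 1 < e3. Proof. by case: F3 => _ []. Qed.
Lemma e1_gt0 : 0 < e1. Proof. exact: lt_trans ltr01 e1_gt1. Qed.
Lemma e2_gt0 : 0 < e2. Proof. exact: lt_trans ltr01 e2_gt1. Qed.
Lemma e3_gt0 : 0 < e3. Proof. exact: lt_trans ltr01 e3_gt1. Qed.
Lemma e1_neq0 : e1 != 0. Proof. exact: lt0r_neq0 e1_gt0. Qed.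
Lemma e2_neq0 : e2 != 0. Proof. exact: lt0r_neq0 e2_gt0. Qed.
Lemma e3_neq0 : e3 != 0. Proof. exact: lt0r_neq0 e3_gt0. Qed.

Lemma A2e1 : A2 e1 = e1. Proof. by case: F1 => -[/inQsqrt_A2]. Qed.
Lemma A1e2 : A1 e2 = e2. Proof. by case: F2 => -[/inQsqrt_A1]. Qed.
Lemma A1e1 : A1 e1 = n1 / e1. Proof. by rewrite -en1 mulrC mulKf ?e1_neq0. Qed.
Lemma A2e2 : A2 e2 = n2 / e2. Proof. by rewrite -en2 mulrC mulKf ?e2_neq0. Qed.
Lemma A1e3 : A1 e3 = n3 / e3. Proof. by rewrite -en3 mulrC mulKf ?e3_neq0. Qed.
Lemma A2e3 : A2 e3 = n3 / e3.
Proof.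
rewrite -A1e3; have [[/inQsqrt_A12 h _] _] := F3.
by rewrite -{2}h biquad_A1K //; apply/biquad_A2/Ke3.
Qed.

Lemma n1_pm : n1 = 1 \/ n1 = -1.
Proof.
rewrite -en1; apply: pm1_of_norm; [|exact: ue1|exact/algunit_aut/ue1].
by apply: inQsqrt_norm1; case: F1 => -[].
Qed.
Lemma n2_pm : n2 = 1 \/ n2 = -1.
Proof.
rewrite -en2; apply: pm1_of_norm; [|exact: ue2|exact/algunit_aut/ue2].
by apply: inQsqrt_norm2; case: F2 => -[].
Qed.
Lemma n3_pm : n3 = 1 \/ n3 = -1.
Proof.
rewrite -en3; apply: pm1_of_norm; [|exact: ue3|exact/algunit_aut/ue3].
by apply: inQsqrt_norm12; case: F3 => -[].
Qed.

(** Monomials carry no sign: they are positive, so an equality up to sign between them is an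
    equality, and by [emon_eq1] units can be compared through exponent vectors. *)
Definition emon (v : int * int * int) : algC := e1 ^ v.1.1 * e2 ^ v.1.2 * e3 ^ v.2.

Lemma emon_gt0 v : 0 < emon v.
Proof. by rewrite !mulr_gt0 ?exprz_gt0 ?e1_gt0 ?e2_gt0 ?e3_gt0. Qed.

Lemma Kemon v : Kp (emon v).
Proof.
by do 2?apply: biquadM; apply: biquadXz; [exact: Ke1|exact: Ke2|exact: Ke3].
Qed.

Lemma unit_emon v : algunit (emon v).
Proof.
by do 2?apply: algunitM; apply: algunitXz; [exact: ue1|exact: ue2|exact: ue3].
Qed.

(* The product of the norms of [f] to the three quadratic subfields is
   [f ^+ 2] times its absolute norm. *)
Lemma kubota (m : nat) f : (0 < m)%N -> Kp f -> algunit (m%:R * f ^+ 2) ->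
  exists v, m%:R * f ^+ 2 = emon v.
Proof.
move=> m_gt0 Kf um; have m0 : (m%:R : algC) != 0 by rewrite pnatr_eq0 -lt0n.
have f0 : f != 0 by case: um => _; rewrite mulf_eq0 expf_eq0 negb_or => /andP[].
have Kf1 := biquad_A1 _ Kf; have Kf2 := biquad_A2 _ Kf.
have Kmf g : Kp g -> Kp (m%:R * (f * g)).
  by move=> Kg; apply: biquadM; [exact: biquad_nat | exact: biquadM].
have norm_unit (nu : {rmorphism algC -> algC}) : algunit (m%:R * (f * nu f)).
  apply: algunit_sqrt.
  have -> : (m%:R * (f * nu f)) ^+ 2 = m%:R * f ^+ 2 * nu (m%:R * f ^+ 2).
    by rewrite rmorphM rmorphXn rmorph_nat /=; ring.
  by apply: algunitM => //; exact: algunit_aut.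
pose pm (z w : algC) := z = w \/ z = - w.
have pmM z w z' w' : pm z w -> pm z' w' -> pm (z * z') (w * w').
  by move=> [->|->] [->|->]; [left|right|right|left]; ring.
have [a ha] : exists a : int, pm (m%:R * (f * A2 f)) (e1 ^ a).
  case: F1 => _ [_]; apply; apply/unitOE; split; last exact: norm_unit.
  apply: biquad_fix2; first exact: Kmf.
  by rewrite !rmorphM rmorph_nat /= biquad_A2K //; ring.
have [b hb] : exists b : int, pm (m%:R * (f * A1 f)) (e2 ^ b).
  case: F2 => _ [_]; apply; apply/unitOE; split; last exact: norm_unit.
  apply: biquad_fix1; first exact: Kmf.
  by rewrite !rmorphM rmorph_nat /= biquad_A1K //; ring.
have [c hc] : exists c : int, pm (m%:R * (f * A1 (A2 f))) (e3 ^ c).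
  case: F3 => _ [_]; apply; apply/unitOE; split; last exact: (norm_unit (A1 \o A2)).
  have Kf12 := biquad_A1 _ Kf2.
  apply: biquad_fix12; first exact: Kmf.
  rewrite !rmorphM !rmorph_nat /= (biquad_A12 (A2 f)) // biquad_A2K //.
  by rewrite biquad_A1K //; ring.
exists (a, b, c); rewrite /emon /=.
(* m^2 times the absolute norm of f. It is a sign, being the norm of +- e1^a; positivity of both
   sides settles the sign at the end. *)
pose N := m%:R * (f * A2 f) * A1 (m%:R * (f * A2 f)).
have hN : pm N 1.
  have : pm N (e1 ^ a * A1 (e1 ^ a)).
    apply: (pmM _ _ _ _ ha); case: ha => ->; [left|right] => //; exact: rmorphN.
  rewrite rmorphXzf -expfzMl en1.
  case: n1_pm => ->; rewrite ?exp1rz //.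
  have : pm ((-1) ^ a) 1.
    by case: (int_parity a) => k [] ->; [left; exact: N1Xz_even | right; exact: N1Xz_odd].
  by move=> [->|->] [->|->]; [left|right|right|left]; rewrite ?opprK.
have : pm (m%:R * f ^+ 2 * N) (e1 ^ a * e2 ^ b * e3 ^ c).
  have -> : m%:R * f ^+ 2 * N = m%:R * (f * A2 f) * (m%:R * (f * A1 f)) * (m%:R * (f * A1 (A2 f))).
    by rewrite /N !rmorphM rmorph_nat /=; ring.
  exact: (pmM _ _ _ _ (pmM _ _ _ _ ha hb) hc).
have pos := emon_gt0 (a, b, c); rewrite /emon /= in pos.
have lpos : 0 < m%:R * f ^+ 2 by rewrite mulr_gt0 ?ltr0n // biquad_sqr_gt0.
have : pm (m%:R * f ^+ 2) (e1 ^ a * e2 ^ b * e3 ^ c) -> m%:R * f ^+ 2 = e1 ^ a * e2 ^ b * e3 ^ c.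
  by case=> // h; move: lpos; rewrite h oppr_gt0 => /(lt_trans pos); rewrite ltxx.
move=> concl [] h; apply: concl; case: hN h => ->; rewrite ?mulr1 ?mulrN1.
- by left.
- by move/(congr1 -%R); rewrite opprK; right.
- by right.
- by move/oppr_inj; left.
Qed.

Lemma emon_exp v (k : int) : emon v ^ k = emon (v.1.1 * k, v.1.2 * k, v.2 * k).
Proof. by rewrite /emon !expfzMl !exprz_exp. Qed.

Lemma emonM v w : emon v * emon w = emon (v.1.1 + w.1.1, v.1.2 + w.1.2, v.2 + w.2).
Proof.
by rewrite /emon /= !expfzDr ?e1_neq0 ?e2_neq0 ?e3_neq0 //; ring.
Qed.

Lemma emon_A2 v :
  emon v * A2 (emon v) = (e1 ^ v.1.1) ^+ 2 * (n2 ^ v.1.2 * n3 ^ v.2).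
Proof.
rewrite -{1}en2 /emon !rmorphM /= !rmorphXzf A2e1.
have -> : n3 = e3 * A2 e3 by rewrite A2e3 mulrC divfK ?e3_neq0.
by rewrite !expfzMl; ring.
Qed.

Lemma emon_A1 v :
  emon v * A1 (emon v) = (e2 ^ v.1.2) ^+ 2 * (n1 ^ v.1.1 * n3 ^ v.2).
Proof.
rewrite -{1}en1 -en3 /emon !rmorphM /= !rmorphXzf A1e2.
by rewrite !expfzMl; ring.
Qed.

Lemma emon_A12 v :
  emon v * A1 (A2 (emon v)) = (e3 ^ v.2) ^+ 2 * (n1 ^ v.1.1 * n2 ^ v.1.2).
Proof.
rewrite -{1}en1 /emon !rmorphM /= !rmorphXzf A2e1.
have -> : n2 = e2 * A1 (A2 e2).
  rewrite -biquad_A12 ?A1e2 //; exact: Ke2.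
have -> : A1 (A2 e3) = e3 by apply: inQsqrt_A12; case: F3 => -[].
by rewrite !expfzMl; ring.
Qed.

Lemma sqrM_gt0 (x y z : algC) : 0 < x ^+ 2 -> 0 < z ^+ 2 -> x ^+ 2 = z ^+ 2 * y -> 0 < y.
Proof. by move=> hx hz e; rewrite e pmulr_rgt0 in hx. Qed.

(** The relative norms of m f^2 are the squares of the nonzero real numbers m f nu(f), so the sign
    factors in [emon_A2], [emon_A1], [emon_A12] must be positive. This is the source of all parity
    conditions on exponents. *)
Lemma emon_signs (m : nat) f v : Kp f -> m%:R * f ^+ 2 = emon v ->
  [/\ 0 < n2 ^ v.1.2 * n3 ^ v.2, 0 < n1 ^ v.1.1 * n3 ^ v.2
    & 0 < n1 ^ v.1.1 * n2 ^ v.1.2].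
Proof.
move=> Kf ef; have : m%:R * f ^+ 2 != 0 by rewrite ef lt0r_neq0 ?emon_gt0.
rewrite mulf_eq0 expf_eq0 negb_or /= => /andP[m0 f0].
have Kf1 := biquad_A1 _ Kf; have Kf2 := biquad_A2 _ Kf; have Kf12 := biquad_A1 _ Kf2.
have sq (nu : {rmorphism algC -> algC}) :
    emon v * nu (emon v) = (m%:R * (f * nu f)) ^+ 2.
  by rewrite -ef rmorphM rmorphXn rmorph_nat /=; ring.
have pos (nu : {rmorphism algC -> algC}) : Kp (nu f) -> 0 < (m%:R * (f * nu f)) ^+ 2.
  move=> Kg; apply: biquad_sqr_gt0; last by rewrite !mulf_neq0 ?fmorph_eq0.
  by apply: biquadM; [exact: biquad_nat | exact: biquadM].
split.
- apply: (@sqrM_gt0 _ _ (e1 ^ v.1.1) (pos _ Kf2)); last by rewrite -emon_A2 sq.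
  by rewrite exprn_gt0 ?exprz_gt0 ?e1_gt0.
- apply: (@sqrM_gt0 _ _ (e2 ^ v.1.2) (pos _ Kf1)); last by rewrite -emon_A1 sq.
  by rewrite exprn_gt0 ?exprz_gt0 ?e2_gt0.
- apply: (@sqrM_gt0 _ _ (e3 ^ v.2) (pos (A1 \o A2) Kf12)).
    by rewrite exprn_gt0 ?exprz_gt0 ?e3_gt0.
  by rewrite -emon_A12 -(sq (A1 \o A2)).
Qed.

Lemma pm_sqr (n : algC) (a : int) : n = 1 \/ n = -1 -> (n ^ a) ^+ 2 = 1.
Proof.
case=> ->; rewrite ?exp1rz ?expr1n //.
by case: (int_parity a) => k [] ->; rewrite ?N1Xz_even ?N1Xz_odd ?sqrrN ?expr1n.
Qed.

Lemma expz_gt1_eq1 (e : algC) (a : int) : 1 < e -> e ^ a = 1 -> a = 0.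
Proof.
move=> e_gt1 h; have e_gt0 := lt_trans ltr01 e_gt1.
have key (n : nat) : e ^+ n = 1 -> n = 0%N.
  by move/eqP; rewrite pexprn_eq1 ?ltW // => /orP[/eqP //|/eqP E]; rewrite E ltxx in e_gt1.
case: a h => n; first by move/key->.
rewrite NegzE -exprz_inv -exprnP => h; have /key // : e ^+ n.+1 = 1.
by apply: invr_inj; rewrite invr1 -exprVn.
Qed.

(** Each relative norm leaves, up to sign, the square of a power of a single fundamental unit; a
    further squaring removes the sign, and a real e > 1 is not a root of unity. *)
Lemma emon_eq1 v : emon v = 1 -> v = (0, 0, 0).
Proof.
case: v => -[a b] c ev.
have gt0 (e : algC) (k : int) : 1 < e -> (e ^ k) ^+ 2 ^+ 2 = 1 -> k = 0.
  move=> e_gt1; rewrite -exprM -[_ ^+ (2 * 2)]/((e ^ k) ^ 4) exprz_exp.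
  by move/(expz_gt1_eq1 _ _ e_gt1); lia.
have sq (x y z w : algC) : 1 = x * (y * z) -> w = x ^+ 2 -> y ^+ 2 = 1 -> z ^+ 2 = 1 -> w = 1.
  by move=> h -> hy hz; rewrite -[RHS](expr1n _ 2) h !exprMn hy hz !mulr1.
have h2 := emon_A2 (a, b, c); have h1 := emon_A1 (a, b, c); have h12 := emon_A12 (a, b, c).
rewrite ev !rmorph1 mulr1 /= in h1 h2 h12.
have p1 k := pm_sqr n1 k n1_pm; have p2 k := pm_sqr n2 k n2_pm; have p3 k := pm_sqr n3 k n3_pm.
by congr (_, _, _); apply: gt0 (sq _ _ _ _ _ erefl _ _);
  [exact: e1_gt1|exact: h2|exact: p2|exact: p3|exact: e2_gt1|exact: h1|exact: p1|exact: p3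
  |exact: e3_gt1|exact: h12|exact: p1|exact: p2].
Qed.

(** The matrix with columns w1, w2, w3 applied to k. *)
Definition lincomb (w1 w2 w3 : int * int * int) (k : int * int * int) : int * int * int :=
  (w1.1.1 * k.1.1 + w2.1.1 * k.1.2 + w3.1.1 * k.2,
   w1.1.2 * k.1.1 + w2.1.2 * k.1.2 + w3.1.2 * k.2,
   w1.2 * k.1.1 + w2.2 * k.1.2 + w3.2 * k.2).

Lemma emon_lincomb w1 w2 w3 k :
  emon w1 ^ k.1.1 * emon w2 ^ k.1.2 * emon w3 ^ k.2 = emon (lincomb w1 w2 w3 k).
Proof. by rewrite !emon_exp !emonM. Qed.

(* Raising to the 8th power kills the roots of unity occurring in the
   decompositions, so that only exponent vectors have to be compared. *)
Lemma FSU3_exp8 (L : algC -> Prop) (u1 u2 u3 : algC) w1 w2 w3 :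
  (forall z w, L z -> L w -> L (z * w)) -> (forall z, L z -> L z^-1) -> L 1 ->
  unitO L u1 -> unitO L u2 -> unitO L u3 ->
  u1 ^+ 8 = emon w1 -> u2 ^+ 8 = emon w2 -> u3 ^+ 8 = emon w3 ->
  (forall k, lincomb w1 w2 w3 k = (0, 0, 0) -> k = (0, 0, 0)) ->
  (forall e, unitO L e -> exists k, e ^+ 8 = emon (lincomb w1 w2 w3 k)) ->
  FSU3 L u1 u2 u3.
Proof.
move=> LM LV L1 U1 U2 U3 h1 h2 h3 indep gen.
have LX z n : L z -> L (z ^+ n).
  by move=> Lz; elim: n => // n IHn; rewrite exprS; apply: LM.
have LXz z (n : int) : L z -> L (z ^ n).
  by move=> Lz; case: n => n; rewrite ?NegzE -?exprz_inv; apply: LX => //; apply: LV.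
have exp8 (k : int * int * int) :
    (u1 ^ k.1.1 * u2 ^ k.1.2 * u3 ^ k.2) ^+ 8 = emon (lincomb w1 w2 w3 k).
  have swap (u : algC) (n : int) : (u ^ n) ^+ 8 = (u ^+ 8) ^ n.
    by rewrite !exprnP !exprz_exp mulrC.
  by rewrite !exprMn !swap h1 h2 h3 emon_lincomb.
split=> //; split=> //; split=> // e Ue; have [k ek] := gen e Ue; exists k.
set U := u1 ^ k.1.1 * u2 ^ k.1.2 * u3 ^ k.2.
have U0 : U != 0.
  by have := lt0r_neq0 (emon_gt0 (lincomb w1 w2 w3 k)); rewrite -exp8 expf_eq0.
split.
  exists (e / U); split; last by rewrite -2!mulrA [u1 ^ _ * _]mulrA -/U divfK.
  split; last by exists 8%N; split=> //; rewrite expr_div_n exp8 ek divff // lt0r_neq0 ?emon_gt0.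
  apply: (LM e); first by case: Ue.
  case: U1 U2 U3 => [L1u _] [L2u _] [L3u _].
  exact: (LV _ (LM _ _ (LM _ _ (LXz _ _ L1u) (LXz _ _ L2u)) (LXz _ _ L3u))).
(* Uniqueness: the second decomposition may involve any root of unity z, so the 8th powers are
   raised further to an exponent n with z^n = 1. *)
move=> k' [z [[_ [n [n_gt0 zn]]] ek']].
have : emon (lincomb w1 w2 w3 (k.1.1 - k'.1.1, k.1.2 - k'.1.2, k.2 - k'.2)) ^ n = 1.
  have e0 : emon (lincomb w1 w2 w3 k') ^+ n != 0.
    by rewrite expf_neq0 // lt0r_neq0 ?emon_gt0.
  apply: (mulIf e0); rewrite mul1r -exprnP -exprMn emonM.
  have -> : emon (lincomb w1 w2 w3 k') ^+ n = (e ^+ 8) ^+ n.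
    have {}ek' : e = z * (u1 ^ k'.1.1 * u2 ^ k'.1.2 * u3 ^ k'.2) by rewrite ek' !mulrA.
    by rewrite -exp8 -!exprM mulnC !exprM ek' [in RHS]exprMn zn mul1r.
  rewrite ek; congr (emon _ ^+ _); rewrite /lincomb /=.
  by congr (_, _, _); ring.
rewrite emon_exp => /emon_eq1 [] /=; rewrite -/(lincomb _ _ _ _).
have n0 : n%:Z != 0 by rewrite -lt0n in n_gt0 *.
move=> /eqP + /eqP + /eqP; rewrite !mulf_eq0 (negbTE n0) !orbF.
move=> /eqP q1 /eqP q2 /eqP q3.
have := indep (k.1.1 - k'.1.1, k.1.2 - k'.1.2, k.2 - k'.2).
rewrite {1}/lincomb /= q1 q2 q3 => /(_ erefl) [].
case: k k' {ek U U0 ek' q1 q2 q3} => -[a b] c [[a' b'] c'] /= *.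
by congr (_, _, _); apply/eqP; rewrite -subr_eq0; apply/eqP.
Qed.

Lemma unitO_biquadi_emon e : unitO KK e -> exists (b : bool) zeta f v,
  [/\ KK zeta, zeta ^+ 4 = 1, Kp f, e = zeta * (1 + 'i) ^+ b * f
    & (two_pow b)%:R * f ^+ 2 = emon v].
Proof.
case/unitOE => Ke ue.
have [b [zeta [f [Kzeta zeta4 Kf ee uf]]]] := biquadi_unit_form e Ke ue.
have [|v ev] := kubota (two_pow b) f _ Kf uf; first by case: (b).
by exists b, zeta, f, v.
Qed.

Lemma one_plus_i_sqr : (1 + 'i) ^+ 2 = 2 * 'i :> algC.
Proof.
have -> : (1 + 'i) ^+ 2 = 1 + 'i ^+ 2 + 2 * 'i :> algC by ring.
by rewrite sqrCi subrr add0r.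
Qed.

Lemma expi4 : 'i ^+ 4 = 1 :> algC.
Proof. by rewrite expr4 sqrCi sqrrN expr1n. Qed.

Lemma exp8 (x : algC) : x ^+ 8 = (x ^+ 2) ^+ 4.
Proof. by rewrite -exprM. Qed.

(** e^2 is zeta^2 i^b times the monomial, and the fourth power kills both roots of unity: hence the
    exponent 8. *)
Lemma unitO_biquadi_exp8 e b zeta f v : zeta ^+ 4 = 1 ->
  e = zeta * (1 + 'i) ^+ (b : bool) * f -> (two_pow b)%:R * f ^+ 2 = emon v ->
  e ^+ 8 = emon v ^+ 4.
Proof.
move=> zeta4 -> <-.
have p2 : ((1 + 'i) ^+ b) ^+ 2 = (two_pow b)%:R * 'i ^+ b :> algC.
  by case: b; rewrite ?expr0 ?expr1 ?one_plus_i_sqr // expr1n mulr1.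
have -> : (zeta * (1 + 'i) ^+ b * f) ^+ 8 =
    (zeta ^+ 4) ^+ 2 * ('i ^+ b) ^+ 4 * ((two_pow b)%:R * f ^+ 2) ^+ 4.
  rewrite exp8 [(_ * f) ^+ 2]exprMn [(zeta * _) ^+ 2]exprMn p2; ring.
rewrite zeta4 expr1n mul1r; case: b {p2}; last by rewrite expr0 expr1n mul1r.
by rewrite expr1 expi4 mul1r.
Qed.

(** * Criteria for fundamental systems and for the unit index *)

Section Basis.
Variables (u1 u2 u3 : algC) (c1 c2 c3 : nat) (v1 v2 v3 : int * int * int).
Hypotheses (E1 : u1 ^+ 2 = 'i ^+ c1 * emon v1) (E2 : u2 ^+ 2 = 'i ^+ c2 * emon v2)
  (E3 : u3 ^+ 2 = 'i ^+ c3 * emon v3).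
Hypothesis indep : forall k, lincomb v1 v2 v3 k = (0, 0, 0) -> k = (0, 0, 0).

Let unit_of_sqr u c v : u ^+ 2 = 'i ^+ c * emon v -> algunit u.
Proof.
move=> e; apply: algunit_sqrt; rewrite e.
by apply: algunitM; [apply/algunitX/algunit_i | exact: unit_emon].
Qed.

Let exp8_of_sqr u c v : u ^+ 2 = 'i ^+ c * emon v ->
  u ^+ 8 = emon (v.1.1 * 4, v.1.2 * 4, v.2 * 4).
Proof.
by move=> e; rewrite exp8 e exprMn -exprM mulnC exprM expi4 expr1n mul1r exprnP emon_exp.
Qed.

(** The u_j are known through their squares, so the vectors v_j are doubled exponents: (2, 0, 0)
    stands for e1 itself, and (0, 0, 1) for a square root of e3 or of i e3. *)
Lemma FSU3_sqr (L : algC -> Prop) :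
  (forall z w, L z -> L w -> L (z * w)) -> (forall z, L z -> L z^-1) -> L 1 ->
  L u1 -> L u2 -> L u3 ->
  (forall e, unitO L e -> exists k, e ^+ 8 = emon (lincomb v1 v2 v3 k) ^+ 4) ->
  FSU3 L u1 u2 u3.
Proof.
move=> LM LV L1 L1u L2u L3u gen.
apply: (@FSU3_exp8 L u1 u2 u3 (v1.1.1 * 4, v1.1.2 * 4, v1.2 * 4)
  (v2.1.1 * 4, v2.1.2 * 4, v2.2 * 4) (v3.1.1 * 4, v3.1.2 * 4, v3.2 * 4)) => //.
- by apply/unitOE; split=> //; exact: unit_of_sqr E1.
- by apply/unitOE; split=> //; exact: unit_of_sqr E2.
- by apply/unitOE; split=> //; exact: unit_of_sqr E3.
- exact: exp8_of_sqr E1.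
- exact: exp8_of_sqr E2.
- exact: exp8_of_sqr E3.
- move=> k; rewrite /lincomb /= => -[h1 h2 h3]; apply: indep; rewrite /lincomb.
  by congr (_, _, _); lia.
move=> e Ue; have [k ek] := gen e Ue; exists k; rewrite ek exprnP emon_exp /lincomb /=.
by congr emon; congr (_, _, _); ring.
Qed.

(** The roots of unity and the powers of i disappear in 8th powers, so it suffices that the v_j span
    every exponent vector of a monomial f^2 or 2 f^2. *)
Lemma FSU3_biquadi : KK u1 -> KK u2 -> KK u3 ->
  (forall (b : bool) f v, Kp f -> (two_pow b)%:R * f ^+ 2 = emon v ->
     exists k, v = lincomb v1 v2 v3 k) ->
  FSU3 KK u1 u2 u3.
Proof.
move=> K1 K2 K3 gen; apply: FSU3_sqr => //.
- exact: biquadiM.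
- exact: biquadiV.
- exact: biquadi1.
move=> e /unitO_biquadi_emon[b [zeta [f [v [Kzeta zeta4 Kf ee ev]]]]].
have [k ek] := gen b f v Kf ev; exists k; rewrite -ek.
exact: unitO_biquadi_exp8 zeta4 ee ev.
Qed.

Lemma FSU3_biquad : Kp u1 -> Kp u2 -> Kp u3 ->
  (forall f v, Kp f -> f ^+ 2 = emon v -> exists k, v = lincomb v1 v2 v3 k) ->
  FSU3 Kp u1 u2 u3.
Proof.
move=> K1 K2 K3 gen; apply: FSU3_sqr => //.
- exact: biquadM.
- exact: biquadV.
- exact: biquad1.
move=> e /unitOE[Ke ue]; have [||v ev] // := kubota 1 e _ Ke.
  by rewrite mul1r; exact: algunitX.
rewrite mul1r in ev; have [k ek] := gen e v Ke ev.
by exists k; rewrite exp8 ev ek.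
Qed.
End Basis.

(** A unit involving 1 + i would produce a monomial of the form 2 f^2. *)
Lemma hasse_index1 : (forall f v, Kp f -> 2 * f ^+ 2 <> emon v) -> hasse_index KK Kp 1.
Proof.
move=> no2; exists (fun=> 1); split.
  by move=> _; apply/unitOE; split; [exact: biquadi1 | exact: algunit1].
move=> e Ue; exists ord0; split; last by move=> j _; rewrite [RHS]ord1.
have [b [zeta [f [v [Kzeta zeta4 Kf ee ev]]]]] := unitO_biquadi_emon e Ue.
case: b ee ev => /= ee ev; first by case: (no2 f v).
exists zeta, f; split; first by split=> //; exists 4%N.
split; last by rewrite ee divr1 expr0 mulr1.
apply/unitOE; split=> //; apply: algunit_sqrt.
by move: ev; rewrite mul1r => ->; exact: unit_emon.
Qed.

Lemma rootU_zeta4 zeta : KK zeta -> zeta ^+ 4 = 1 -> rootU KK zeta.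
Proof. by move=> Kz z4; split=> //; exists 4%N. Qed.

Lemma in_WE_of_even e zeta f v : KK zeta -> zeta ^+ 4 = 1 -> Kp f ->
  e = zeta * (1 + 'i) ^+ false * f -> 1%:R * f ^+ 2 = emon v -> in_WE KK Kp e.
Proof.
move=> Kzeta zeta4 Kf ->; rewrite mul1r expr0 mulr1 => ev.
exists zeta, f; split; first exact: rootU_zeta4.
split=> //; apply/unitOE; split=> //; apply: algunit_sqrt.
by rewrite ev; exact: unit_emon.
Qed.

(** If zeta (1 + i) f were z h with z a root of unity and h real, absolute values would give (h /
    f)^2 = 2 in K^+. *)
Lemma one_plus_i_notin_WE zeta f e : zeta ^+ 4 = 1 -> Kp f ->
  e = zeta * (1 + 'i) * f -> e != 0 -> ~ in_WE KK Kp e.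
Proof.
move=> zeta4 Kf -> e0 [z [h [[Kz [n [n_gt0 zn]]] [/unitOE[Kh uh] E]]]].
have zeta_n1 (x : algC) (m : nat) : (0 < m)%N -> x ^+ m = 1 -> `|x| = 1.
  move=> m_gt0 xm; apply/eqP; rewrite -(@pexpr_eq1 _ _ m) ?normr_ge0 //.
  by rewrite -normrX xm normr1.
have f0 : f != 0 by apply: contraNneq e0 => ->; rewrite mulr0.
apply: (no_sqrt2 (h / f)); first exact: biquad_div.
have en : `|1 + 'i| = `|h / f|.
  have := congr1 Num.norm E; rewrite !normrM (zeta_n1 _ _ n_gt0 zn) (zeta_n1 zeta 4%N) //.
  by rewrite !mul1r => <-; rewrite normfV mulfK // normr_eq0.
have r : h / f \is Num.real by apply: biquad_real; exact: biquad_div.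
rewrite -(real_normK r) -en normCK rmorphD rmorph1 /= conjCi.
have -> : (1 + 'i) * (1 - 'i) = 1 - 'i ^+ 2 :> algC by ring.
by rewrite sqrCi opprK.
Qed.

(** The cosets are represented by 1 and t: t involves the factor 1 + i, and this factor cancels in
    the quotient of any two units that involve it. *)
Lemma hasse_index2 t v : KK t -> t ^+ 2 = 'i * emon v -> hasse_index KK Kp 2.
Proof.
move=> Kt et; have ut : algunit t.
  by apply: algunit_sqrt; rewrite et; apply: algunitM; [exact: algunit_i | exact: unit_emon].
have [_ t0 _] := ut.
have Ut : unitO KK t by apply/unitOE.
have [b [zeta [f [w [Kzeta zeta4 Kf ef ew]]]]] := unitO_biquadi_emon t Ut.
have zeta0 : zeta != 0 by apply/eqP=> h; move/eqP: zeta4; rewrite h expr0n eq_sym oner_eq0.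
have bt : b = true.
  (* Without the factor 1 + i, t^2 would be +- f^2, putting i in the real field K^+. *)
  case: b ef ew => // ef ew; exfalso.
  have z2 : zeta ^+ 2 = 1 \/ zeta ^+ 2 = -1 by apply: sqr_eq; rewrite -expr4 zeta4 expr1n.
  have Ki : Kp 'i.
    have ev0 := lt0r_neq0 (emon_gt0 v).
    have -> : 'i = zeta ^+ 2 * (f ^+ 2 / emon v).
      by apply: (mulIf ev0); rewrite -[RHS]mulrA divfK // -et ef expr0 mulr1 exprMn.
    apply: biquadM; last by apply: biquad_div; [exact: biquadX | exact: Kemon].
    by case: z2 => ->; [exact: biquad1 | exact/biquadN/biquad1].
  have := biquad_conj _ Ki; rewrite conjCi => /eqP; rewrite eq_sym -subr_eq0 opprK.
  by rewrite -mulr2n mulrn_eq0 (negbTE (neq0Ci _)).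
rewrite bt /= expr1 in ef ew.
have f0 : f != 0 by apply: contraNneq t0 => h; rewrite ef h mulr0.
have i0 := one_plus_i_neq0.
have tW : ~ in_WE KK Kp t by exact: one_plus_i_notin_WE zeta4 Kf ef t0.
exists (fun j : 'I_2 => if j == 0 then 1 else t); split.
  by move=> j; case: ifP => _ //; apply/unitOE; split; [exact: biquadi1 | exact: algunit1].
move=> e Ue; have [c [z [g [w' [Kz z4 Kg eg ew']]]]] := unitO_biquadi_emon e Ue.
have [_ [_ [e0 _]]] := Ue.
have g0 : g != 0 by apply: contraNneq e0 => h; rewrite eg h mulr0.
case: c eg ew' => eg ew'.
  have eW : ~ in_WE KK Kp e by exact: one_plus_i_notin_WE z4 Kg eg e0.
  exists 1; split.
    exists (z / zeta), (g / f); split.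
      apply: rootU_zeta4; first by apply: biquadiM => //; exact: biquadiV.
      by rewrite expr_div_n z4 zeta4 divr1.
    split; last by rewrite /= eg ef expr1; field; rewrite f0 i0 zeta0.
    apply/unitOE; split; first exact: biquad_div.
    apply: algunit_sqrt; have -> : (g / f) ^+ 2 = emon w' / emon w.
      by rewrite -ew -ew' /two_pow; field.
    by apply: algunitM; [|apply: algunitV]; exact: unit_emon.
  move=> j; case: eqP => [-> |j0 _]; first by rewrite divr1 => /eW.
  by apply/val_inj; case: j j0 => -[|[|]] //= j_lt [] //; apply/val_inj.
have eW : in_WE KK Kp e by exact: in_WE_of_even Kz z4 Kg eg ew'.
exists 0; split; first by rewrite eqxx divr1.
move=> j; case: eqP => [-> //|j0] etW; case: tW.
case: eW => z1 [h1 [[Kz1 [n1' [n1_gt0 z1n]]] [/unitOE[Kh1 uh1] e1']]].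
case: etW => z2 [h2 [[Kz2 [n2' [n2_gt0 z2n]]] [/unitOE[Kh2 uh2] e2']]].
have et' : t = (z1 / z2) * (h1 / h2).
  have h20 : h2 != 0 by case: uh2.
  have z20 : z2 != 0 by apply/eqP=> h; move/eqP: z2n; rewrite h expr0n -leqn0 leqNgt n2_gt0 eq_sym oner_eq0.
  have : e = z2 * h2 * t by rewrite -e2' divfK.
  rewrite e1' => eq12; rewrite mulf_div eq12; field.
  by rewrite z20 h20.
exists (z1 / z2), (h1 / h2); split; last split=> //.
  split; first by apply: biquadiM => //; exact: biquadiV.
  exists (n1' * n2')%N; split; first by rewrite muln_gt0 n1_gt0.
  by rewrite expr_div_n exprM z1n expr1n mulnC exprM z2n expr1n divr1.
apply/unitOE; split; first exact: biquad_div.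
by apply: algunitM => //; exact: algunitV.
Qed.

(** * Squares in K^+ *)

Definition is_sq (z : algC) : Prop := exists f, Kp f /\ f ^+ 2 = z.

Lemma is_sqM z w : is_sq z -> is_sq w -> is_sq (z * w).
Proof.
move=> [f [Kf <-]] [g [Kg <-]]; exists (f * g); split; first exact: biquadM.
by rewrite exprMn.
Qed.

Lemma is_sq_sqr z : Kp z -> is_sq (z ^+ 2).
Proof. by exists z. Qed.

Lemma is_sq_divr z w : is_sq (z * w) -> is_sq w -> w != 0 -> is_sq z.
Proof.
move=> [f [Kf ef]] [g [Kg eg]] w0; exists (f / g); split; first exact: biquad_div.
by rewrite expr_div_n ef eg mulfK.
Qed.

Lemma is_sq_emon_shift v w k :
  v = (w.1.1 + 2 * k.1.1, w.1.2 + 2 * k.1.2, w.2 + 2 * k.2) ->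
  is_sq (emon v) <-> is_sq (emon w).
Proof.
move=> ->; have -> : emon (w.1.1 + 2 * k.1.1, w.1.2 + 2 * k.1.2, w.2 + 2 * k.2)
    = emon w * emon k ^+ 2.
  rewrite exprnP emon_exp emonM /=; congr emon; congr (_, _, _); lia.
have k2 := is_sq_sqr _ (Kemon k).
split=> [h|h]; last exact: is_sqM.
by apply: is_sq_divr h k2 _; rewrite expf_neq0 // lt0r_neq0 ?emon_gt0.
Qed.

Lemma two_sqr_emon f v : Kp f -> 2 * f ^+ 2 = emon v -> is_sq (emon v) -> False.
Proof.
move=> Kf ef [g [Kg eg]]; apply: (no_sqrt2 (g / f)); first exact: biquad_div.
have f0 : f != 0.
  by apply: contraTneq (emon_gt0 v) => f0; rewrite -ef f0 expr0n mulr0 ltxx.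
by rewrite expr_div_n eg -ef mulfK // expf_neq0.
Qed.

(** i z = (i / 2) (2 z), and i / 2 is the square of (1 + i) / 2. *)
Lemma sqrt_i_mul z : is_sq (2 * z) -> exists t, KK t /\ t ^+ 2 = 'i * z.
Proof.
move=> [g [Kg eg]]; exists ((1 + 'i) / 2 * g); split.
  apply: biquadiM; last exact: biquad_biquadi.
  apply: biquadiM; last by apply/biquadiV/biquad_biquadi/biquad_nat.
  by exists 1, 1; rewrite mulr1; do ?split; exact: biquad1.
by rewrite exprMn eg expr_div_n one_plus_i_sqr; field.
Qed.

Lemma emon010 : emon (0, 1, 0) = e2. Proof. by rewrite /emon /= expr1z !expr0z mulr1 mul1r. Qed.
Lemma emon001 : emon (0, 0, 1) = e3. Proof. by rewrite /emon /= expr1z !expr0z !mul1r. Qed.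
Lemma emon111 : emon (1, 1, 1) = e1 * e2 * e3. Proof. by rewrite /emon /= !expr1z. Qed.
Lemma emon011 : emon (0, 1, 1) = e2 * e3. Proof. by rewrite /emon /= !expr1z expr0z mul1r. Qed.

Lemma emon200 : e1 ^+ 2 = 'i ^+ 0 * emon (2, 0, 0).
Proof. by rewrite /emon /= !expr0z !mulr1 mul1r. Qed.
Lemma emon020 : e2 ^+ 2 = 'i ^+ 0 * emon (0, 2, 0).
Proof. by rewrite /emon /= !expr0z mulr1 !mul1r. Qed.
Lemma emon002 : e3 ^+ 2 = 'i ^+ 0 * emon (0, 0, 2).
Proof. by rewrite /emon /= !expr0z !mul1r. Qed.

Lemma N1Xz_gt0 (a : int) : 0 < (-1 : algC) ^ a -> exists k, a = 2 * k.
Proof.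
case: (int_parity a) => k [] -> h; first by exists k.
by move: h; rewrite N1Xz_odd oppr_gt0 => /(lt_trans ltr01); rewrite ltxx.
Qed.

Lemma N1XzM_gt0 (a b : int) : 0 < (-1 : algC) ^ a * (-1) ^ b -> exists k, a = b + 2 * k.
Proof.
rewrite -expfzDr ?oppr_eq0 ?oner_eq0 // => /N1Xz_gt0[k ek].
by exists (k - b); lia.
Qed.

(** * Fundamental systems of units in the four cases *)

Hypothesis n1N : n1 = -1.

(** With all norms -1, [emon_signs] makes the three exponents of f^2 or 2 f^2 congruent modulo 2, so
    modulo squares the only nontrivial monomial is e1 e2 e3. *)
Lemma units_case1 : n2 = -1 -> n3 = -1 ->
  is_sq (e1 * e2 * e3) \/ is_sq (2 * (e1 * e2 * e3)) ->
  (is_sq (e1 * e2 * e3) -> exists s, Kp s /\ s ^+ 2 = e1 * e2 * e3 /\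
     FSU3 Kp e1 e2 s /\ FSU3 KK e1 e2 s /\ hasse_index KK Kp 1) /\
  (~ is_sq (e1 * e2 * e3) -> FSU3 Kp e1 e2 e3 /\
     (exists s, KK s /\ s ^+ 2 = 'i * e1 * e2 * e3 /\ FSU3 KK e1 e2 s) /\
     hasse_index KK Kp 2).
Proof.
move=> n2N n3N dich.
have par (m : nat) f v : Kp f -> m%:R * f ^+ 2 = emon v ->
    exists k l, v = (v.2 + 2 * k, v.2 + 2 * l, v.2).
  move=> Kf ef; have [h1 h2 _] := emon_signs m f v Kf ef; move: h1 h2.
  rewrite n1N n2N n3N => /N1XzM_gt0[l el] /N1XzM_gt0[k ek]; exists k, l.
  by case: v ef el ek => -[a b] c _ /= -> ->.
have indep k : lincomb (2, 0, 0) (0, 2, 0) (1, 1, 1) k = (0, 0, 0) -> k = (0, 0, 0).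
  by case: k => -[a b] c [] /= h1 h2 h3; congr (_, _, _); lia.
have gen (m : nat) f v : Kp f -> m%:R * f ^+ 2 = emon v ->
    exists k, v = lincomb (2, 0, 0) (0, 2, 0) (1, 1, 1) k.
  move=> Kf /(par m f v Kf)[k [l ->]]; exists (k, l, v.2); rewrite /lincomb /=.
  by congr (_, _, _); lia.
have Kb1 := biquad_biquadi _ Ke1; have Kb2 := biquad_biquadi _ Ke2.
split=> [[s [Ks es]]|nsq].
  have E3 : s ^+ 2 = 'i ^+ 0 * emon (1, 1, 1) by rewrite expr0 mul1r emon111.
  exists s; split=> //; split=> //; split; [|split].
  - apply: (FSU3_biquad _ _ _ _ _ _ _ _ _ emon200 emon020 E3) => //; [exact: Ke1|exact: Ke2|].
    by move=> f v Kf ef; apply: (gen 1%N f) => //; rewrite mul1r.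
  - apply: (FSU3_biquadi _ _ _ _ _ _ _ _ _ emon200 emon020 E3) => //; first exact: biquad_biquadi.
    by move=> b f v Kf ef; apply: (gen (two_pow b) f).
  apply: hasse_index1 => f v Kf ef; apply: (two_sqr_emon _ _ Kf ef).
  have [k [l ev]] := par 2%N _ _ Kf ef.
  have [j [ej|ej]] := int_parity v.2.
    apply/(is_sq_emon_shift _ (0, 0, 0) (k + j, l + j, j)); last by exists 1; split; [exact: biquad1|rewrite expr1n /emon /= !expr0z !mulr1].
    by rewrite ev /=; congr (_, _, _); lia.
  apply/(is_sq_emon_shift _ (1, 1, 1) (k + j, l + j, j)); last by exists s; rewrite es emon111.
  by rewrite ev /=; congr (_, _, _); lia.
have [//|/sqrt_i_mul[t [Kt et]]] := dich.
have E3 : t ^+ 2 = 'i ^+ 1 * emon (1, 1, 1) by rewrite expr1 emon111.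
split; [|split].
- apply: (FSU3_biquad _ _ _ _ _ _ _ _ _ emon200 emon020 emon002) => //; [|exact: Ke1|exact: Ke2|exact: Ke3|].
    by case=> -[a b] c [] /= h1 h2 h3; congr (_, _, _); lia.
  move=> f v Kf ef; have [|k [l ev]] := par 1%N f v Kf; first by rewrite mul1r.
  have [j [ej|ej]] := int_parity v.2.
    by exists (k + j, l + j, j); rewrite ev ej /lincomb /=; congr (_, _, _); lia.
  case: nsq; rewrite -emon111; apply/(is_sq_emon_shift v (1, 1, 1) (k + j, l + j, j)); last by exists f.
  by rewrite ev /=; congr (_, _, _); lia.
- exists t; split=> //; split; first by rewrite et !mulrA.
  apply: (FSU3_biquadi _ _ _ _ _ _ _ _ _ emon200 emon020 E3) => //.
  by move=> b f v Kf ef; apply: (gen (two_pow b) f).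
by apply: (hasse_index2 t (1, 1, 1)) => //; rewrite emon111.
Qed.

(** Here the exponents of e1 and e3 are even, which leaves only e2 modulo squares. *)
Lemma units_case2 : n2 = 1 -> n3 = -1 -> ~ is_sq e2 -> is_sq (2 * e2) ->
  FSU3 Kp e1 e2 e3 /\ (exists s, KK s /\ s ^+ 2 = 'i * e2 /\ FSU3 KK e1 s e3) /\
  hasse_index KK Kp 2.
Proof.
move=> n2P n3N nsq /sqrt_i_mul[t [Kt et]].
have par (m : nat) f v : Kp f -> m%:R * f ^+ 2 = emon v ->
    exists k l, v = (2 * k, v.1.2, 2 * l).
  move=> Kf ef; have [h1 _ h2] := emon_signs m f v Kf ef; move: h1 h2.
  rewrite n1N n2P n3N !exp1rz mul1r mulr1 => /N1Xz_gt0[l el] /N1Xz_gt0[k ek]; exists k, l.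
  by case: v ef el ek => -[a b] c _ /= -> ->.
have Kb1 := biquad_biquadi _ Ke1; have Kb3 := biquad_biquadi _ Ke3.
have E2 : t ^+ 2 = 'i ^+ 1 * emon (0, 1, 0) by rewrite expr1 emon010.
split; [|split].
- apply: (FSU3_biquad _ _ _ _ _ _ _ _ _ emon200 emon020 emon002) => //; [|exact: Ke1|exact: Ke2|exact: Ke3|].
    by case=> -[a b] c [] /= h1 h2 h3; congr (_, _, _); lia.
  move=> f v Kf ef; have [|k [l ev]] := par 1%N f v Kf; first by rewrite mul1r.
  have [j [ej|ej]] := int_parity v.1.2.
    by exists (k, j, l); rewrite ev ej /lincomb /=; congr (_, _, _); lia.
  case: nsq; rewrite -emon010; apply/(is_sq_emon_shift v (0, 1, 0) (k, j, l)); last by exists f.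
  by rewrite ev /=; congr (_, _, _); lia.
- exists t; split=> //; split=> //.
  apply: (FSU3_biquadi _ _ _ _ _ _ _ _ _ emon200 E2 emon002) => //.
    by case=> -[a b] c [] /= h1 h2 h3; congr (_, _, _); lia.
  move=> b f v Kf /(par _ f v Kf)[k [l ->]]; exists (k, v.1.2, l); rewrite /lincomb /=.
  by congr (_, _, _); lia.
by apply: (hasse_index2 t (0, 1, 0)) => //; rewrite emon010.
Qed.

(** Here the exponents of e1 and e2 are even, which leaves only e3 modulo squares. *)
Lemma units_case3 : n3 = 1 -> n2 = -1 -> 
  (is_sq e3 -> exists s, Kp s /\ s ^+ 2 = e3 /\
     FSU3 Kp e1 e2 s /\ FSU3 KK e1 e2 s /\ hasse_index KK Kp 1) /\
  (~ is_sq e3 -> is_sq (2 * e3) -> FSU3 Kp e1 e2 e3 /\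
     (exists s, KK s /\ s ^+ 2 = 'i * e3 /\ FSU3 KK e1 e2 s) /\ hasse_index KK Kp 2).
Proof.
move=> n3P n2N.
have par (m : nat) f v : Kp f -> m%:R * f ^+ 2 = emon v ->
    exists k l, v = (2 * k, 2 * l, v.2).
  move=> Kf ef; have [h1 h2 _] := emon_signs m f v Kf ef; move: h1 h2.
  rewrite n1N n2N n3P !exp1rz !mulr1 => /N1Xz_gt0[l el] /N1Xz_gt0[k ek]; exists k, l.
  by case: v ef el ek => -[a b] c _ /= -> ->.
have indep k : lincomb (2, 0, 0) (0, 2, 0) (0, 0, 1) k = (0, 0, 0) -> k = (0, 0, 0).
  by case: k => -[a b] c [] /= h1 h2 h3; congr (_, _, _); lia.
have gen (m : nat) f v : Kp f -> m%:R * f ^+ 2 = emon v ->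
    exists k, v = lincomb (2, 0, 0) (0, 2, 0) (0, 0, 1) k.
  move=> Kf /(par m f v Kf)[k [l ->]]; exists (k, l, v.2); rewrite /lincomb /=.
  by congr (_, _, _); lia.
have Kb1 := biquad_biquadi _ Ke1; have Kb2 := biquad_biquadi _ Ke2.
split=> [[s [Ks es]]|nsq /sqrt_i_mul[t [Kt et]]].
  have E3 : s ^+ 2 = 'i ^+ 0 * emon (0, 0, 1) by rewrite expr0 mul1r emon001.
  exists s; split=> //; split=> //; split; [|split].
  - apply: (FSU3_biquad _ _ _ _ _ _ _ _ _ emon200 emon020 E3) => //; [exact: Ke1|exact: Ke2|].
    by move=> f v Kf ef; apply: (gen 1%N f) => //; rewrite mul1r.
  - apply: (FSU3_biquadi _ _ _ _ _ _ _ _ _ emon200 emon020 E3) => //; first exact: biquad_biquadi.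
    by move=> b f v Kf ef; apply: (gen (two_pow b) f).
  apply: hasse_index1 => f v Kf ef; apply: (two_sqr_emon _ _ Kf ef).
  have [k [l ev]] := par 2%N _ _ Kf ef.
  have [j [ej|ej]] := int_parity v.2.
    apply/(is_sq_emon_shift _ (0, 0, 0) (k, l, j)); last by exists 1; split; [exact: biquad1|rewrite expr1n /emon /= !expr0z !mulr1].
    by rewrite ev /=; congr (_, _, _); lia.
  apply/(is_sq_emon_shift _ (0, 0, 1) (k, l, j)); last by exists s; rewrite es emon001.
  by rewrite ev /=; congr (_, _, _); lia.
have E3 : t ^+ 2 = 'i ^+ 1 * emon (0, 0, 1) by rewrite expr1 emon001.
split; [|split].
- apply: (FSU3_biquad _ _ _ _ _ _ _ _ _ emon200 emon020 emon002) => //; [|exact: Ke1|exact: Ke2|exact: Ke3|].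
    by case=> -[a b] c [] /= h1 h2 h3; congr (_, _, _); lia.
  move=> f v Kf ef; have [|k [l ev]] := par 1%N f v Kf; first by rewrite mul1r.
  have [j [ej|ej]] := int_parity v.2.
    by exists (k, l, j); rewrite ev ej /lincomb /=; congr (_, _, _); lia.
  case: nsq; rewrite -emon001; apply/(is_sq_emon_shift v (0, 0, 1) (k, l, j)); last by exists f.
  by rewrite ev /=; congr (_, _, _); lia.
- exists t; split=> //; split=> //.
  apply: (FSU3_biquadi _ _ _ _ _ _ _ _ _ emon200 emon020 E3) => //.
  by move=> b f v Kf ef; apply: (gen (two_pow b) f).
by apply: (hasse_index2 t (0, 0, 1)) => //; rewrite emon001.
Qed.

(** Only the exponent of e1 is forced to be even, so e2, e3 and e2 e3 remain modulo squares. As 2 e2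
    is a square, e3 not being one makes 2 e3 and hence e2 e3 squares. *)
Lemma units_case4 : n2 = 1 -> n3 = 1 -> ~ is_sq e2 -> is_sq (2 * e2) ->
  (is_sq e3 -> exists s t, Kp s /\ s ^+ 2 = e3 /\ KK t /\ t ^+ 2 = 'i * e2 /\
     FSU3 Kp e1 e2 s /\ FSU3 KK e1 t s /\ hasse_index KK Kp 2) /\
  (~ is_sq e3 -> is_sq (2 * e3) ->
     exists s t, Kp s /\ s ^+ 2 = e2 * e3 /\ KK t /\ t ^+ 2 = 'i * e3 /\
     FSU3 Kp e1 e2 s /\ FSU3 KK e1 s t /\ hasse_index KK Kp 2).
Proof.
move=> n2P n3P nsq2 sq2.
have par (m : nat) f v : Kp f -> m%:R * f ^+ 2 = emon v ->
    exists k, v = (2 * k, v.1.2, v.2).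
  move=> Kf ef; have [_ h _] := emon_signs m f v Kf ef; move: h.
  rewrite n1N n3P !exp1rz !mulr1 => /N1Xz_gt0[k ek]; exists k.
  by case: v ef ek => -[a b] c _ /= ->.
have Kb1 := biquad_biquadi _ Ke1; have Kb2 := biquad_biquadi _ Ke2.
split=> [[s [Ks es]]|nsq3 sq3].
  have [t [Kt et]] := sqrt_i_mul _ sq2.
  have E3 : s ^+ 2 = 'i ^+ 0 * emon (0, 0, 1) by rewrite expr0 mul1r emon001.
  have E2 : t ^+ 2 = 'i ^+ 1 * emon (0, 1, 0) by rewrite expr1 emon010.
  exists s, t; do 4?split=> //; split; [|split].
  - apply: (FSU3_biquad _ _ _ _ _ _ _ _ _ emon200 emon020 E3) => //; [|exact: Ke1|exact: Ke2|].
      by case=> -[a b] c [] /= h1 h2 h3; congr (_, _, _); lia.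
    move=> f v Kf ef; have [|k ev] := par 1%N f v Kf; first by rewrite mul1r.
    have [j [ej|ej]] := int_parity v.1.2.
      by exists (k, j, v.2); rewrite ev /lincomb /=; congr (_, _, _); lia.
    case: nsq2; have sq : is_sq (emon (0, 1, v.2)).
      apply/(is_sq_emon_shift v (0, 1, v.2) (k, j, 0)); last by exists f.
      by rewrite ev /=; congr (_, _, _); lia.
    rewrite -emon010; have [l [el|el]] := int_parity v.2.
      apply/(is_sq_emon_shift (0, 1, v.2) (0, 1, 0) (0, 0, l)) => //=.
      by congr (_, _, _); lia.
    have sq' : is_sq (emon (0, 1, 1)).
      apply/(is_sq_emon_shift (0, 1, v.2) (0, 1, 1) (0, 0, l)) => //=.
      by congr (_, _, _); lia.
    rewrite emon010; apply: (is_sq_divr _ e3); rewrite -?emon011 //; last exact: e3_neq0.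
    by exists s.
  - apply: (FSU3_biquadi _ _ _ _ _ _ _ _ _ emon200 E2 E3) => //; last first.
    + move=> b f v Kf /(par _ f v Kf)[k ->]; exists (k, v.1.2, v.2); rewrite /lincomb /=.
      by congr (_, _, _); lia.
    + exact: biquad_biquadi.
    by case=> -[a b] c [] /= h1 h2 h3; congr (_, _, _); lia.
  by apply: (hasse_index2 t (0, 1, 0)) => //; rewrite emon010.
have [t [Kt et]] := sqrt_i_mul _ sq3.
have [s [Ks es]] : is_sq (e2 * e3).
  have sq4 : is_sq (2 ^+ 2) by apply/is_sq_sqr/biquad_nat.
  apply: (is_sq_divr _ (2 ^+ 2)) => //; last by rewrite expf_neq0 // pnatr_eq0.
  have -> : e2 * e3 * 2 ^+ 2 = 2 * e2 * (2 * e3) by ring.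
  exact: is_sqM.
have E2 : s ^+ 2 = 'i ^+ 0 * emon (0, 1, 1) by rewrite expr0 mul1r emon011.
have E3 : t ^+ 2 = 'i ^+ 1 * emon (0, 0, 1) by rewrite expr1 emon001.
exists s, t; do 4?split=> //; split; [|split].
- apply: (FSU3_biquad _ _ _ _ _ _ _ _ _ emon200 emon020 E2) => //; [|exact: Ke1|exact: Ke2|].
    by case=> -[a b] c [] /= h1 h2 h3; congr (_, _, _); lia.
  move=> f v Kf ef; have [|k ev] := par 1%N f v Kf; first by rewrite mul1r.
  have [j [ej|ej]] := int_parity (v.1.2 - v.2).
    by exists (k, j, v.2); rewrite ev /lincomb /=; congr (_, _, _); lia.
  exfalso; have [l [el|el]] := int_parity v.2.
    apply: nsq2; rewrite -emon010; apply/(is_sq_emon_shift v (0, 1, 0) (k, j + l, l)); last by exists f.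
    by rewrite ev /=; congr (_, _, _); lia.
  apply: nsq3; rewrite -emon001; apply/(is_sq_emon_shift v (0, 0, 1) (k, j + l + 1, l)); last by exists f.
  by rewrite ev /=; congr (_, _, _); lia.
- apply: (FSU3_biquadi _ _ _ _ _ _ _ _ _ emon200 E2 E3) => //; last first.
  + move=> b f v Kf /(par _ f v Kf)[k ->]; exists (k, v.1.2, v.2 - v.1.2); rewrite /lincomb /=.
    by congr (_, _, _); lia.
  + exact: biquad_biquadi.
  by case=> -[a b] c [] /= h1 h2 h3; congr (_, _, _); lia.
by apply: (hasse_index2 t (0, 0, 1)) => //; rewrite emon001.
Qed.

(** * Integral multiples of monomials that are squares *)

Lemma norm1_sqclass e w : e * w = 1 -> (exists a : rat, e + w = ratr a) -> algunit e -> 0 < e ->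
  exists n : nat, (0 < n)%N /\ n%:R * e = (1 + e) ^+ 2.
Proof.
move=> ew [a ea] ue e_gt0; have [e_int e0 eV_int] := ue.
have w_e : w = e^-1 by rewrite -[w](mulKf e0) ew mulr1.
have w_gt0 : 0 < w by rewrite w_e invr_gt0.
have [n en] : exists n : int, a = n%:~R.
  by apply: Aint_ratr; rewrite -ea w_e rpredD.
have n_gt0 : 0 < n.
  rewrite -(ltr0z rat) -en -(ltr0q algC) -ea; exact: addr_gt0.
(* Hilbert 90 made explicit: e = (1 + e) / (1 + w), so the multiplier is (1 + e)(1 + w) = 2 + (e +
   w). *)
exists (`|n|.+2)%N; split=> //.
have -> : (`|n|.+2)%:R = 2 + (e + w) :> algC.
  rewrite ea en rmorph_int -addn2 natrD addrC; congr (_ + _).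
  by rewrite pmulrn gtz0_abs.
have -> : (2 + (e + w)) * e = 2 * e + e ^+ 2 + e * w by ring.
by rewrite ew; ring.
Qed.

Lemma sqclass2 : n2 = 1 -> exists n : nat, (0 < n)%N /\ is_sq (n%:R * e2).
Proof.
move=> n2P; have [||||n [n_gt0 en]] := @norm1_sqclass e2 (A2 e2).
- by rewrite en2.
- apply: biquad_fix; first by apply: biquadD; [|apply: biquad_A2]; exact: Ke2.
  + by rewrite rmorphD /= -(biquad_A12 _ Ke2) A1e2.
  + by rewrite rmorphD /= (biquad_A2K _ Ke2) addrC.
- exact: ue2.
- exact: e2_gt0.
exists n; split=> //; rewrite en; apply: is_sq_sqr.
by apply: biquadD; [exact: biquad1 | exact: Ke2].
Qed.

Lemma sqclass3 : n3 = 1 -> exists n : nat, (0 < n)%N /\ is_sq (n%:R * e3).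
Proof.
move=> n3P; have [||||n [n_gt0 en]] := @norm1_sqclass e3 (A1 e3).
- by rewrite en3.
- apply: biquad_fix; first by apply: biquadD; [|apply: biquad_A1]; exact: Ke3.
  + by rewrite rmorphD /= (biquad_A1K _ Ke3) addrC.
  + rewrite rmorphD /= (biquad_A12 _ Ke3).
    have -> : A1 (A2 e3) = e3 by apply: inQsqrt_A12; case: F3 => -[].
    by rewrite A2e3 A1e3 addrC.
- exact: ue3.
- exact: e3_gt0.
exists n; split=> //; rewrite en; apply: is_sq_sqr.
by apply: biquadD; [exact: biquad1 | exact: Ke3].
Qed.

(* [K^+(sqrt xi)] is an elementary abelian 2-extension of Q: with [S = sqrt xi],
   the trace [S + e1 / S + e2 / S - e3 / S] of [S] has a rational square. *)
Lemma sqclass123 : n2 = -1 -> n3 = -1 ->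
  exists n : nat, (0 < n)%N /\ is_sq (n%:R * (e1 * e2 * e3)).
Proof.
move=> n2N n3N.
have [z1 z2 z3] := And3 e1_neq0 e2_neq0 e3_neq0.
set xi := e1 * e2 * e3; pose T := xi + e1 + e2 - e3.
have xi0 : xi != 0 by rewrite !mulf_neq0.
have Kxi : Kp xi by do 2?apply: biquadM; [exact: Ke1|exact: Ke2|exact: Ke3].
have KT : Kp T.
  by apply: biquadB; [|exact: Ke3]; apply: biquadD; [|exact: Ke2]; apply: biquadD; [|exact: Ke1].
(* [T] must not vanish, or the multiplier below would be 0. *)
have T_gt0 : 0 < T.
  have -> : T = (e1 * e2 - 1) * e3 + e1 + e2 by rewrite /T /xi; ring.
  have h : 1 < e1 * e2 by rewrite -[1]mulr1 ltr_pM ?ler01 ?e1_gt1 ?e2_gt1.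
  by rewrite !addr_gt0 ?e1_gt0 ?e2_gt0 // mulr_gt0 ?e3_gt0 // subr_gt0.
have A1T : A1 (T ^+ 2 / xi) = T ^+ 2 / xi.
  rewrite /T /xi rmorphM rmorphXn fmorphV !(rmorphD, rmorphN, rmorphM) /= A1e1 A1e2 A1e3 n1N n3N.
  by field; rewrite z1 z2 z3.
have A2T : A2 (T ^+ 2 / xi) = T ^+ 2 / xi.
  rewrite /T /xi rmorphM rmorphXn fmorphV !(rmorphD, rmorphN, rmorphM) /= A2e1 A2e2 A2e3 n2N n3N.
  by field; rewrite z1 z2 z3.
have [|a ea] := @biquad_fix (T ^+ 2 / xi) _ A1T A2T.
  by apply: biquad_div => //; exact: biquadX.
have [u1_int _ _] := ue1; have [u2_int _ _] := ue2; have [u3_int _ _] := ue3.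
have [_ _ xiV_int] : algunit xi.
  by do 2?apply: algunitM; [exact: ue1|exact: ue2|exact: ue3].
have [n en] : exists n : int, a = n%:~R.
  by apply: Aint_ratr; rewrite -ea rpredM // rpredX // rpredB // !rpredD // !rpredM.
have n_gt0 : 0 < n.
  rewrite -(ltr0z rat) -en -(ltr0q algC) -ea divr_gt0 ?exprn_gt0 //.
  by rewrite !mulr_gt0 ?e1_gt0 ?e2_gt0 ?e3_gt0.
exists `|n|%N; split; first by rewrite absz_gt0 gt_eqF.
have -> : (`|n|)%:R = T ^+ 2 / xi by rewrite ea en rmorph_int pmulrn gtz0_abs.
by rewrite divfK //; exact: is_sq_sqr.
Qed.

(** * When a fundamental unit is a square in K^+ *)

Lemma fund_nonsq d e f : fund_unit d e -> inQsqrt d f -> f ^+ 2 = e -> False.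
Proof.
move=> [/unitOE[_ ue] [e_gt1 gen]] Qf ef; have e_gt0 := lt_trans ltr01 e_gt1.
have [|k hk] := gen f; first by apply/unitOE; split=> //; apply: algunit_sqrt; rewrite ef.
have f2 : f ^+ 2 = e ^ (2 * k) by case: hk => ->; rewrite ?sqrrN mulrC -exprz_exp.
have : e ^ (2 * k - 1) = 1.
  rewrite expfzDr ?lt0r_neq0 // -f2 ef.
  by rewrite -exprz_inv expr1z divff // lt0r_neq0.
by move/(expz_gt1_eq1 _ _ e_gt1); lia.
Qed.

(** [A1] sends a root f of e2 to f or -f. The first would put f in Q(sqrt d2), where a fundamental
    unit is no square; so f s1 lies there. *)
Lemma is_sq_e2 : is_sq e2 -> exists g, inQsqrt d2 g /\ d1%:R * e2 = g ^+ 2.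
Proof.
move=> [f [Kf ef]].
have [h|h] : A1 f = f \/ A1 f = - f by apply: sqr_eq; rewrite -rmorphXn ef A1e2.
  by case: (fund_nonsq _ _ _ F2 (biquad_fix1 _ Kf h) ef).
exists (f * s1); split; last by rewrite exprMn ef sqrtCK mulrC.
apply: biquad_fix1; first by apply: biquadM => //; exact: biquad_s1.
by rewrite rmorphM /= h A1s1 mulrNN.
Qed.

Lemma is_sq_e1 : is_sq e1 -> exists g, inQsqrt d1 g /\ d2%:R * e1 = g ^+ 2.
Proof.
move=> [f [Kf ef]].
have [h|h] : A2 f = f \/ A2 f = - f by apply: sqr_eq; rewrite -rmorphXn ef A2e1.
  by case: (fund_nonsq _ _ _ F1 (biquad_fix2 _ Kf h) ef).
exists (f * s2); split; last by rewrite exprMn ef sqrtCK mulrC.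
apply: biquad_fix2; first by apply: biquadM => //; exact: biquad_s2.
by rewrite rmorphM /= h A2s2 mulrNN.
Qed.

Lemma quadratic_inj (d : nat) (a b a' b' : rat) : nonsq d ->
  ratr a + ratr b * sqrtC d%:R = ratr a' + ratr b' * sqrtC d%:R :> algC -> a = a' /\ b = b'.
Proof.
move=> dN h; have [|h1 h2] := @quadratic_eq0 d (a - a') (b - b') dN.
  by rewrite !rmorphB /= mulrBl addrACA -opprD h subrr.
by split; apply/eqP; rewrite -subr_eq0 ?h1 ?h2.
Qed.

Lemma e3_norm_eq (x y : int) : e3 = x%:~R + y%:~R * sqrtC (d1 * d2)%:R -> n3 = 1 ->
  (x%:~R : rat) ^+ 2 - (d1 * d2)%:R * y%:~R ^+ 2 = 1.
Proof.
move=> ex n3P; apply: ratr_inj.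
rewrite !(rmorphXn, rmorph_nat, rmorph_int, rmorph1, rmorphB, rmorphM) /=.
apply: etrans n3P; rewrite -en3 ex sqrtCM12 rmorphD !rmorphM /= !rmorph_int A1s1 A1s2.
have h1 := sqr_sqrtC_nat d1; have h2 := sqr_sqrtC_nat d2.
by rewrite ?natrM; move: s1 s2 h1 h2 => t1 t2 <- <-; ring.
Qed.

(** As for e2, g = f s1 = a + b sqrt (d1 d2) has g^2 = d1 e3. Its rational part gives a^2 + d1 d2
    b^2 = d1 x, its norm gives a^2 - d1 d2 b^2 = +- d1, and the sum is 2 a^2 = d1 (x +- 1). *)
Lemma is_sq_e3 (x y : int) : e3 = x%:~R + y%:~R * sqrtC (d1 * d2)%:R -> n3 = 1 ->
  is_sq e3 ->
  is_sq_nat ((2 * d1)%:Z * (x + 1)) \/ is_sq_nat ((2 * d1)%:Z * (x - 1)).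
Proof.
move=> ex n3P [f [Kf ef]].
have QQ : inQsqrt (d1 * d2) e3 by case: F3 => -[].
have [h|h] : A1 (A2 f) = f \/ A1 (A2 f) = - f.
  by apply: sqr_eq; rewrite -!rmorphXn ef inQsqrt_A12.
  by case: (fund_nonsq _ _ _ F3 (biquad_fix12 _ Kf h) ef).
have [||a [b eg]] := @biquad_fix12 (f * s1).
- by apply: biquadM => //; exact: biquad_s1.
- by rewrite !rmorphM /= h A2s1 A1s1 mulrNN.
have g2 : (f * s1) ^+ 2 = d1%:R * e3 by rewrite exprMn ef sqrtCK mulrC.
have h1 := sqr_sqrtC_nat d1; have h2 := sqr_sqrtC_nat d2.
have [hx _] : a ^+ 2 + (d1 * d2)%:R * b ^+ 2 = d1%:R * x%:~R /\ 2 * a * b = d1%:R * y%:~R.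
  apply: (@quadratic_inj (d1 * d2)) => //.
  have -> : ratr (d1%:R * x%:~R) + ratr (d1%:R * y%:~R) * sqrtC (d1 * d2)%:R = d1%:R * e3 :> algC.
    by rewrite ex !rmorphM /= !rmorph_nat !rmorph_int; ring.
  rewrite -g2 eg sqrtCM12 !(rmorphXn, rmorph_nat, rmorphD, rmorphM) /=.
  by move: s1 s2 h1 h2 => t1 t2 <- <-; ring.
have hn : a ^+ 2 - (d1 * d2)%:R * b ^+ 2 = d1%:R \/ a ^+ 2 - (d1 * d2)%:R * b ^+ 2 = - d1%:R.
  apply: sqr_eq; apply: ratr_inj; rewrite rmorphXn [RHS]rmorphXn rmorph_nat /=.
  have -> : ratr (a ^+ 2 - (d1 * d2)%:R * b ^+ 2) = (f * s1) * A1 (f * s1).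
    rewrite eg sqrtCM12 !(fmorph_rat, rmorphXn, rmorph_nat, rmorphD, rmorphN, rmorphM) /=.
    by rewrite A1s1 A1s2; move: s1 s2 h1 h2 => t1 t2 <- <-; ring.
  rewrite exprMn -rmorphXn g2 rmorphM /= rmorph_nat.
  by rewrite mulrACA en3 n3P mulr1 expr2.
have sqn (z : int) : 2 * a ^+ 2 = d1%:R * z%:~R -> is_sq_nat ((2 * d1)%:Z * z).
  move=> ea; have [m em] : exists m : int, 2 * a = m%:~R.
    apply: Aint_ratr; apply: Aint_sqrt; rewrite -rmorphXn.
    have -> : (2 * a) ^+ 2 = (2 * d1%:R) * z%:~R by rewrite -mulrA -ea; ring.
    by rewrite !rmorphM /= !rmorph_nat rmorph_int !rpredM ?Aint_int // Aint_Cnat ?natr_nat.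
  exists `|m|%N; have -> : (`|m| ^ 2)%:Z = m ^+ 2 by rewrite -abszX gez0_abs ?sqr_ge0.
  apply: (@intr_inj rat); rewrite intrM rmorphXn /= -em -pmulrn natrM -mulrA -ea; ring.
case: hn => hn; [left|right]; apply: sqn; rewrite ?intrD ?intrB; lra.
Qed.

(** For c = +-1 and z = x + c + y sqrt (d1 d2), the norm equation gives z^2 = 2 (x + c) e3. So if 2
    d1 (x + c) = k^2, a root of e3 is s1 z / k. *)
Lemma is_sq_e3_conv (x y : int) : e3 = x%:~R + y%:~R * sqrtC (d1 * d2)%:R -> n3 = 1 ->
  is_sq_nat ((2 * d1)%:Z * (x + 1)) \/ is_sq_nat ((2 * d1)%:Z * (x - 1)) -> is_sq e3.
Proof.
move=> ex n3P h.
have hn := e3_norm_eq x y ex n3P.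
have d1_neq0 : (d1%:R : algC) != 0.
  by rewrite -(sqr_sqrtC_nat d1) expf_neq0 // s1_neq0.
have [c [k [c1 hk]]] : exists (c : int) (k : nat), c ^+ 2 = 1 /\ (2 * d1)%:Z * (x + c) = (k ^ 2)%:Z.
  by case: h => -[k hk]; [exists 1, k|exists (-1), k].
have c1r : (c%:~R : algC) ^+ 2 = 1 by rewrite -rmorphXn c1.
have hkC : 2 * d1%:R * (x%:~R + c%:~R) = k%:R ^+ 2 :> algC.
  have := congr1 (fun z : int => z%:~R : algC) hk.
  by rewrite /= intrM intrD -!pmulrn natrM natrX.
have hnC : (x%:~R : algC) ^+ 2 - (y%:~R * sqrtC (d1 * d2)%:R) ^+ 2 = 1.
  have := congr1 (fun z : rat => ratr z : algC) hn.
  rewrite /= !(rmorphXn, rmorph_nat, rmorph_int, rmorph1, rmorphB, rmorphM) /= => E.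
  by apply: etrans E; rewrite exprMn sqrtCK ?natrM; ring.
pose z := x%:~R + c%:~R + y%:~R * sqrtC (d1 * d2)%:R : algC.
have hz : d1%:R * z ^+ 2 = k%:R ^+ 2 * e3.
  rewrite -hkC ex /z; have -> : forall s : algC, (x%:~R + c%:~R + s) ^+ 2 =
    (x%:~R + c%:~R) ^+ 2 + 2 * (x%:~R + c%:~R) * s + s ^+ 2 by move=> s; ring.
  have -> : (y%:~R * sqrtC (d1 * d2)%:R) ^+ 2 = x%:~R ^+ 2 - c%:~R ^+ 2 :> algC.
    by rewrite -[LHS](subKr (x%:~R ^+ 2)) hnC c1r.
  by ring.
(* k = 0 would force x = -c and a zero irrational part, so e3 = +-1, against e3 > 1. *)
have k0 : (k%:R : algC) != 0.
  apply/eqP=> k0; have xc : x = - c.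
    apply: (@intr_inj algC); move: hkC; rewrite k0 expr0n /= => /eqP.
    by rewrite !mulf_eq0 pnatr_eq0 (negbTE d1_neq0) /= addr_eq0 rmorphN => /eqP.
  have y0 : y%:~R * sqrtC (d1 * d2)%:R = 0 :> algC.
    have : (y%:~R * sqrtC (d1 * d2)%:R) ^+ 2 = 0 :> algC.
      by rewrite -[LHS](subKr (x%:~R ^+ 2)) hnC xc rmorphN sqrrN c1r subrr.
    by move/eqP; rewrite expf_eq0 => /eqP.
  have := e3_gt1; rewrite ex y0 addr0 => h1.
  have h2 : (x%:~R : algC) ^+ 2 = 1 by rewrite xc rmorphN sqrrN.
  have : 1 < (x%:~R : algC) ^+ 2 by rewrite exprn_egt1.
  by rewrite h2 ltxx.
exists (s1 * z / k%:R); split; last by rewrite expr_div_n exprMn sqrtCK hz mulrC mulKf // expf_neq0.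
apply: biquad_div; last exact: biquad_nat.
apply: biquadM; first exact: biquad_s1.
apply: biquadD; last first.
  apply: biquadM; first by rewrite -(ratr_int algC); exact: biquad_rat.
  by rewrite sqrtCM12; apply: biquadM; [exact: biquad_s1|exact: biquad_s2].
by rewrite -intrD -(ratr_int algC); exact: biquad_rat.
Qed.

End Fundamental.
End NoSqrt2.
End Biquadratic.

Lemma rat_sqr_int (q : rat) (n : int) : q ^+ 2 = n%:~R -> exists m : int, q = m%:~R.
Proof.
move=> e; apply: Aint_ratr; apply: Aint_sqrt.
by rewrite -rmorphXn e /= rmorph_int Aint_int.
Qed.

Lemma nonsq_prime q n : prime q -> (q %| n)%N -> ~~ (q ^ 2 %| n)%N -> nonsq n.
Proof.
move=> q_pr qn q2n r; apply: contra q2n => /eqP er.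
have [|m em] := @rat_sqr_int r n; first by rewrite er pmulrn.
have en : n = (`|m| ^ 2)%N.
  have e : n%:Z = m ^+ 2 by apply: (@intr_inj rat); rewrite rmorphXn /= -em er pmulrn.
  by rewrite -abszX -e.
by move: qn; rewrite en Euclid_dvdX // => /andP[qm _]; exact: dvdn_exp2r.
Qed.

Lemma biquad_auts d1 d2 : nonsq d1 -> nonsq d2 -> nonsq (d1 * d2) ->
  exists A1 A2 : {rmorphism algC -> algC},
  [/\ A1 (sqrtC d1%:R) = - sqrtC d1%:R, A1 (sqrtC d2%:R) = sqrtC d2%:R & A1 'i = 'i] /\
  [/\ A2 (sqrtC d1%:R) = sqrtC d1%:R, A2 (sqrtC d2%:R) = - sqrtC d2%:R & A2 'i = 'i].
Proof.
move=> N1 N2 N12; have [A1 h1] := sqrt_flip_aut _ _ N1 N2 N12.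
have [A2 [h21 h22 h2i]] : exists nu : {rmorphism algC -> algC},
    [/\ nu (sqrtC d2%:R) = - sqrtC d2%:R, nu (sqrtC d1%:R) = sqrtC d1%:R & nu 'i = 'i].
  by apply: sqrt_flip_aut => //; rewrite mulnC.
by exists A1, A2.
Qed.

(** * Descent to the ramified primes *)

Section Descent.
Variable P : nat -> Prop.
Hypothesis Psqr : forall n m, (0 < m)%N -> P (n * m ^ 2)%N -> P n.

(** [P n] stands for n u being a square in Q(sqrt p, sqrt 2). Unramified primes divide n at least
    twice, and a factor p or 2 can be doubled up because both are squares in this field; so every
    prime is removed. *)
Lemma descent_prime p : prime p -> (forall n, P n -> P (n * p)%N) ->
  (forall n, P n -> P (n * 2)%N) ->
  (forall q n, prime q -> ~~ (q %| 2 * p * 2)%N -> (q %| n)%N -> P n -> (q ^ 2 %| n)%N) ->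
  forall n, (0 < n)%N -> P n -> P 1%N.
Proof.
move=> p_pr Pp P2 Pram n; elim/ltn_ind: n => n IH n_gt0 Pn.
have [n1|n_neq1] := eqVneq n 1%N; first by rewrite -n1.
have q_pr : prime (pdiv n) by rewrite pdiv_prime // ltn_neqAle eq_sym n_neq1.
have := pdiv_dvd n; move: (pdiv n) q_pr => q q_pr qn.
have pos m c : n = (m * c)%N -> (0 < m)%N by case: m => // en; rewrite en in n_gt0.
have q_gt1 := prime_gt1 q_pr; have q_gt0 := prime_gt0 q_pr.
have step m : n = (m * q)%N -> P (m * q ^ 2)%N -> P 1%N.
  move=> en Pm; apply: (IH m); [|exact: pos en|exact: Psqr Pm].
  by rewrite en ltn_Pmulr // (pos _ _ en).
have [/dvdnP[m em]|q_ndvd] := boolP (q %| 2 * p * 2)%N; last first.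
  have /dvdnP[m em] := Pram q n q_pr q_ndvd qn Pn.
  apply: (IH m); [|exact: pos em|by apply: (Psqr m q); rewrite // -em].
  by rewrite em ltn_Pmulr ?(pos _ _ em) // -(exp1n 2) ltn_exp2r.
have : (q %| 2 * p * 2)%N by rewrite em dvdn_mull.
rewrite !Euclid_dvdM // !dvdn_prime2 // -orbA orbCA orbb => /orP[/eqP qp|/eqP q2].
  have /dvdnP[k ek] := qn; apply: (step k ek).
  by rewrite expnS expn1 mulnA -ek qp; apply: Pp.
have /dvdnP[k ek] := qn; apply: (step k ek).
by rewrite expnS expn1 mulnA -ek q2; apply: P2.
Qed.

Lemma prime_factor_odd_or4 n : (2 < n)%N ->
  (exists q, [/\ prime q, odd q & q %| n]%N) \/ (4 %| n)%N.
Proof.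
move=> n_gt2; have odd_case k : odd k -> (1 < k)%N -> (k %| n)%N ->
    exists q, [/\ prime q, odd q & q %| n]%N.
  move=> k_odd k_gt1 kn; exists (pdiv k); split; first exact: pdiv_prime.
    exact: dvdn_odd (pdiv_dvd k) k_odd.
  exact: dvdn_trans (pdiv_dvd k) kn.
have [n_odd|n_even] := boolP (odd n); first by left; apply: (odd_case n) => //; exact: ltnW.
have en : n = (n./2 * 2)%N by rewrite muln2 -[LHS]odd_double_half (negbTE n_even).
have [h_odd|h_even] := boolP (odd n./2).
  left; apply: (odd_case n./2) => //; last by rewrite {2}en dvdn_mulr.
  by move: n_gt2; rewrite {1}en; case: (n./2) => [|[|]].
by right; rewrite en -[4%N]/(2 * 2)%N dvdn_pmul2r // dvdn2.
Qed.

(** Now p1 and 2 p2 are the available squares. A factor p2 can only be traded for a 2, which still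
    lowers n because p2 > 2; factors 4 are dropped, so the descent stops at 1 or 2. *)
Lemma descent_two p1 p2 : prime p1 -> prime p2 -> (2 < p2)%N ->
  (forall n, P n -> P (n * p1)%N) -> (forall n, P n -> P (n * (2 * p2))%N) ->
  (forall q n, prime q -> ~~ (q %| 2 * p1 * (2 * p2))%N -> (q %| n)%N -> P n -> (q ^ 2 %| n)%N) ->
  forall n, (0 < n)%N -> P n -> P 1%N \/ P 2%N.
Proof.
move=> p1_pr p2_pr p2_gt2 Pp1 Pp2 Pram n; elim/ltn_ind: n => n IH n_gt0 Pn.
have [n_gt2|] := ltnP 2 n; last first.
  by case: n n_gt0 Pn {IH} => [|[|[|]]] // _ Pn _; [left|right].
have pos m c : n = (m * c)%N -> (0 < m)%N by case: m => // en; rewrite en in n_gt0.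
case: (prime_factor_odd_or4 _ n_gt2) => [[q [q_pr q_odd qn]]|/dvdnP[m em]]; last first.
  apply: (IH m); [|exact: pos em|by apply: (Psqr m 2%N); rewrite // -em].
  by rewrite em ltn_Pmulr // (pos _ _ em).
have q_gt1 := prime_gt1 q_pr; have q_gt0 := prime_gt0 q_pr.
have /dvdnP[k ek] := qn; have k_gt0 := pos _ _ ek.
have [qp1|qp1] := eqVneq q p1.
  apply: (IH k) => //; first by rewrite ek ltn_Pmulr.
  by apply: (Psqr k q) => //; rewrite expnS expn1 mulnA -ek qp1; apply: Pp1.
have [qp2|qp2] := eqVneq q p2.
  apply: (IH (2 * k)%N); first by rewrite ek mulnC ltn_pmul2l // qp2.
    by rewrite muln_gt0.
  apply: (Psqr _ q) => //.
  have -> : (2 * k * q ^ 2 = n * (2 * p2))%N by rewrite ek -qp2; lia.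
  exact: Pp2.
have q_ndvd : ~~ (q %| 2 * p1 * (2 * p2))%N.
  rewrite !Euclid_dvdM // !dvdn_prime2 // (negbTE qp1) (negbTE qp2) !orbF orbb.
  by apply/eqP=> q2; rewrite q2 in q_odd.
have /dvdnP[m em] := Pram q n q_pr q_ndvd qn Pn.
apply: (IH m); [|exact: pos em|by apply: (Psqr m q); rewrite // -em].
by rewrite em ltn_Pmulr ?(pos _ _ em) // -(exp1n 2) ltn_exp2r.
Qed.
End Descent.

Section SquareClasses.
Variables d1 d2 : nat.
Hypotheses (N1 : nonsq d1) (N2 : nonsq d2) (N12 : nonsq (d1 * d2)).
Variable u : algC.
Hypothesis uu : algunit u.
Let P (n : nat) := is_sq d1 d2 (n%:R * u).

Lemma is_sq_mul_sqr n m : (0 < m)%N -> P (n * m ^ 2) -> P n.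
Proof.
have [A1 [A2 [[a11 a12 a1i] [a21 a22 a2i]]]] := biquad_auts _ _ N1 N2 N12.
move=> m_gt0 h; apply: (is_sq_divr _ _ A1 A2 a11 a12 a21 a22 _ (m%:R ^+ 2)).
- by rewrite mulrAC -natrX -natrM.
- exact/is_sq_sqr/biquad_nat.
by rewrite expf_neq0 // pnatr_eq0 -lt0n.
Qed.

Lemma is_sq_mul1 n : P n -> P (n * d1).
Proof.
move=> h; have := is_sqM _ _ _ _ h (is_sq_sqr _ _ _ (biquad_s1 d1 d2)).
by rewrite sqrtCK mulrAC -natrM.
Qed.

Lemma is_sq_mul2 n : P n -> P (n * d2).
Proof.
move=> h; have := is_sqM _ _ _ _ h (is_sq_sqr _ _ _ (biquad_s2 d1 d2)).
by rewrite sqrtCK mulrAC -natrM.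
Qed.

Lemma is_sq_ram q n : prime q -> ~~ (q %| 2 * d1 * d2)%N -> (q %| n)%N -> P n -> (q ^ 2 %| n)%N.
Proof.
have [A1 [A2 [[a11 a12 a1i] [a21 a22 a2i]]]] := biquad_auts _ _ N1 N2 N12.
move=> q_pr q_ndvd qn [f [Kf ef]].
exact: (unramified_dvd _ _ A1 A2 a11 a12 a21 a22 _ _ u f).
Qed.
End SquareClasses.

(** * The fundamental unit of Q(sqrt p) for a prime p congruent to 1 modulo 4 *)

Lemma qnorm_aut (nu : {rmorphism algC -> algC}) d z n :
  nu (sqrtC d%:R) = - sqrtC d%:R -> qnorm_is d z n -> z * nu z = ratr n.
Proof.
move=> h [a [b [-> <-]]].
rewrite !(fmorph_rat, rmorphXn, rmorph_nat, rmorphD, rmorphN, rmorphM) /= h.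
have e := sqr_sqrtC_nat d.
by move: (sqrtC d%:R) h e => s _ <-; ring.
Qed.

(** Modulo 4 the form becomes c^2 - h^2, which never takes the value 2. *)
Lemma sqr_sub_mod4 (p : nat) (c h : int) : (p %% 4 = 1)%N ->
  c ^+ 2 - p%:Z * h ^+ 2 <> 2 /\ c ^+ 2 - p%:Z * h ^+ 2 <> -2.
Proof.
move=> p1; have ep : p%:Z = 4 * (p %/ 4)%N%:Z + 1 by rewrite {1}(divn_eq p 4) p1; lia.
rewrite ep; move: (p %/ 4)%N%:Z => m.
have [i hi] := int_parity c; have [j hj] := int_parity h.
by case: hi => ->; case: hj => ->; split; rewrite !expr2; nia.
Qed.

(* If the norm were 1, then [n e = (1 + e) ^+ 2] for some [n], which makes [e] a
   square in Q(sqrt p, sqrt 2), hence [e] or [2 e] a square in Q(sqrt p). *)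
Lemma fund_unit_prime_norm p e : prime p -> (p %% 4 = 1)%N -> fund_unit p e ->
  qnorm_is p e (-1).
Proof.
move=> p_pr p1 F; have pn2 : p != 2%N by apply: contra_eqN p1 => /eqP ->.
have p_ndvd2 : ~~ (p %| 2)%N by rewrite dvdn_prime2.
have Np : nonsq p.
  apply: (nonsq_prime _ _ p_pr (dvdnn p)); apply/negP => /dvdn_leq; rewrite prime_gt0 // => /(_ isT).
  by rewrite leqNgt ltn_Pmulr ?prime_gt0 ?prime_gt1.
have N2 : nonsq 2 by apply: (nonsq_prime 2).
have Np2 : nonsq (p * 2).
  apply: (nonsq_prime 2) => //; first exact: dvdn_mull.
  by rewrite dvdn_pmul2r // dvdn_prime2 // eq_sym.
have [A1 [A2 [[a11 a12 a1i] [a21 a22 a2i]]]] := biquad_auts _ _ Np N2 Np2.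
have [/unitOE[[a [b ea]] ue] [e_gt1 _]] := F.
exists a, b; split=> //.
have en : e * A1 e = ratr (a ^+ 2 - p%:R * b ^+ 2).
  by apply: (qnorm_aut _ p) => //; exists a, b.
have [e1|e1] : e * A1 e = 1 \/ e * A1 e = -1.
- by apply: (n1_pm _ _ A1 A2 a11 a12 a21 a22 _ _ F).
- exfalso.
  have A1e : A1 e = ratr a - ratr b * sqrtC p%:R.
    by rewrite ea !(fmorph_rat, rmorphD, rmorphM) /= a11 mulrN.
  have [||n [n_gt0 en']] := @norm1_sqclass e (A1 e) e1 _ ue.
    by exists (2 * a); rewrite A1e ea rmorphM rmorph_nat /=; ring.
    exact: lt_trans ltr01 e_gt1.
  have sq : is_sq p 2 (n%:R * e).
    rewrite en'; apply: is_sq_sqr; apply: biquadD; first exact: biquad1.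
    by apply: inQsqrt_biquad1; exists a, b.
  have : is_sq p 2 (1%:R * e).
    apply: (descent_prime (fun n => is_sq p 2 (n%:R * e)) _ p p_pr _ _ _ n) => //.
    - by move=> *; apply: (is_sq_mul_sqr p 2 Np N2 Np2 e); eassumption.
    - by move=> *; apply: is_sq_mul1.
    - by move=> *; apply: is_sq_mul2.
    - by move=> q m *; apply: (is_sq_ram p 2 Np N2 Np2 e ue).
  rewrite mul1r => /(is_sq_e1 _ _ A2 a21 a22 e F)[g [[c [h eg]] eg2]].
  have s2 := sqr_sqrtC_nat p.
  have [hc _] : 2 * a = c ^+ 2 + p%:R * h ^+ 2 /\ 2 * b = 2 * c * h.
    apply: (@quadratic_inj p) => //.
    have -> : ratr (2 * a) + ratr (2 * b) * sqrtC p%:R = 2%:R * e :> algC.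
      by rewrite ea !rmorphM !rmorph_nat /=; ring.
    rewrite eg2 eg !(rmorphXn, rmorph_nat, rmorphD, rmorphM) /=.
    by move: (sqrtC p%:R) s2 => s <-; ring.
  have hn : c ^+ 2 - p%:R * h ^+ 2 = 2 \/ c ^+ 2 - p%:R * h ^+ 2 = - 2.
    apply: sqr_eq; apply: ratr_inj; rewrite rmorphXn [RHS]rmorphXn rmorph_nat /=.
    rewrite -(qnorm_aut A1 p g _ a11); last by exists c, h.
    by rewrite exprMn -rmorphXn -eg2 rmorphM rmorph_nat mulrACA e1; ring.
  have uA : e + A1 e \in Aint by case: ue => ue' _ _; rewrite rpredD ?Aint_aut.
  have [T eT] : exists n : int, 2 * a = n%:~R.
    apply: Aint_ratr; have -> : ratr (2 * a) = e + A1 e; last exact: uA.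
    by rewrite A1e ea rmorphM rmorph_nat /=; ring.
  have g_int : g \in Aint.
    by case: ue => e_int _ _; apply: Aint_sqrt; rewrite -eg2 rpredM ?rpred_nat.
  have [C eC] : exists n : int, 2 * c = n%:~R.
    apply: Aint_ratr; have -> : ratr (2 * c) = g + A1 g; last by rewrite rpredD ?Aint_aut.
    by rewrite eg !(fmorph_rat, rmorph_nat, rmorphD, rmorphM) /= a11; ring.
  (* Coordinates are so far only half-integral. This equation makes C = 2 c even, so c is an
     integer; then p h^2 is an integer, and h is one since p is prime. *)
  have hC : C * C = 2 * T + 4 \/ C * C = 2 * T - 4.
    case: hn => hn; [left|right]; apply: (@intr_inj rat).
      by rewrite intrD !intrM -eC -eT; lra.
    by rewrite intrB !intrM -eC -eT; lra.
  have [c' ec'] : exists c' : int, c = c'%:~R.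
    have [i [hi|hi]] := int_parity C; last by case: hC; nia.
    exists i; move: eC; rewrite hi intrM; lra.
  have [h' eh'] : exists h' : int, h = h'%:~R.
    have hM : p%:R * h ^+ 2 = (T - c' ^+ 2)%:~R by rewrite intrB -eT rmorphXn /= -ec' hc; ring.
    have [|H eH] := @rat_sqr_int (p%:R * h) (p%:Z * (T - c' ^+ 2)).
      by rewrite intrM -hM -pmulrn; ring.
    have p0 : (p%:R : rat) != 0 by rewrite pnatr_eq0 -lt0n prime_gt0.
    have eH2 : H ^+ 2 = p%:Z * (T - c' ^+ 2).
      by apply: (@intr_inj rat); rewrite rmorphXn intrM /= -eH -hM -pmulrn; ring.
    have /dvdzP[k ek] : (p %| H)%Z.
      have : (p %| `|H| ^ 2)%N by rewrite -abszX eH2 abszM dvdn_mulr.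
      by rewrite Euclid_dvdX // => /andP[].
    exists k; apply: (mulfI p0); rewrite eH ek intrM mulrC -pmulrn //.
  have [m2 mN2] := sqr_sub_mod4 p c' h' p1.
  case: hn => hn; [apply: m2|apply: mN2]; apply: (@intr_inj rat);
    by rewrite intrB intrM !rmorphXn /= -pmulrn -ec' -eh' hn.
by apply: ratr_inj; rewrite -en e1 rmorphN1.
Qed.

(** * Distinctness of the two primes *)

Lemma prime_mod4_odd p : (p %% 4 = 1)%N -> p != 2%N.
Proof. by move=> p1; apply: contra_eqN p1 => /eqP ->. Qed.

Lemma prime_mod4_neq3 p : (p %% 4 = 1)%N -> p != 3%N.
Proof. by move=> p1; apply: contra_eqN p1 => /eqP ->. Qed.

Lemma nonsq_prime_mul q m : prime q -> ~~ (q %| m)%N -> nonsq (q * m).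
Proof.
move=> q_pr q_ndvd; apply: (nonsq_prime q) => //; first exact: dvdn_mulr.
by rewrite expnS expn1 dvdn_pmul2l // prime_gt0.
Qed.

(* If [p1 = p2 = p], the field of [eps3] is [Q(sqrt 2)] and [1 + sqrt 2] is not
   a power of an element of [Z[p sqrt 2]]. *)
Lemma fund_unit_distinct p (e : algC) (x y : int) : prime p -> (p %% 4 = 1)%N ->
  fund_unit (p * (2 * p)) e -> e = x%:~R + y%:~R * sqrtC (p * (2 * p))%:R -> False.
Proof.
move=> p_pr p1 F ex.
have pn2 := prime_mod4_odd _ p1.
have p2 : ~~ (p %| 2)%N by rewrite dvdn_prime2.
have tp : ~~ (2 %| p)%N by rewrite dvdn_prime2 // eq_sym.
have Np : nonsq p by rewrite -[p]muln1; apply: nonsq_prime_mul => //; rewrite dvdn1 neq_ltn prime_gt1 ?orbT.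
have N2p : nonsq (2 * p) by exact: nonsq_prime_mul.
have ND : nonsq (p * (2 * p)).
  by rewrite mulnCA; apply: nonsq_prime_mul; rewrite // Euclid_dvdM // orbb.
have [A1 [A2 [[a11 a12 a1i] [a21 a22 a2i]]]] := biquad_auts _ _ Np N2p ND.
set D := (p * (2 * p))%N in F ex ND; set s : algC := sqrtC D%:R.
have s2 : s ^+ 2 = D%:R by exact: sqrtCK.
have A1s : A1 s = - s by rewrite /s sqrtCM12 rmorphM /= a11 a12 mulNr.
(* The order Z[sqrt D]. It contains e, and e^-1 because the norm is +-1, hence every unit of the
   field; but 1 + sqrt 2 is a unit with irrational coordinate 1 / p. *)
pose S (z : algC) := exists u v : int, z = u%:~R + v%:~R * s.
have SM z w : S z -> S w -> S (z * w).
  move=> [u [v ->]] [u' [v' ->]]; exists (u * u' + D%:Z * (v * v')), (u * v' + v * u').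
  rewrite !(intrD, intrM) -pmulrn -s2; ring.
have SN z : S z -> S (- z).
  by move=> [u [v ->]]; exists (- u), (- v); rewrite !mulrNz; ring.
have S1 : S 1 by exists 1, 0; rewrite mul0r addr0.
have SX z n : S z -> S (z ^+ n).
  by move=> Sz; elim: n => [|n IH] //; rewrite exprS; apply: SM.
have Se : S e by exists x, y.
have [/unitOE[_ [_ e0 _]] [_ gen]] := F.
have SA : S (A1 e).
  by exists x, (- y); rewrite ex rmorphD rmorphM /= !rmorph_int A1s mulrNz; ring.
have SeV : S e^-1.
  have [h|h] := n3_pm _ _ A1 A2 a11 a12 a21 a22 _ _ F erefl.
    by have -> : e^-1 = A1 e by apply: (mulfI e0); rewrite mulfV.
  have -> : e^-1 = - A1 e by apply: (mulfI e0); rewrite mulfV // mulrN h opprK.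
  exact: SN.
have SXz (k : int) : S (e ^ k).
  by case: k => k; rewrite ?NegzE -?exprz_inv; exact: SX.
have p0 : (p%:R : algC) != 0 by rewrite pnatr_eq0 -lt0n prime_gt0.
pose w := s / p%:R.
have w2 : w ^+ 2 = 2.
  by rewrite expr_div_n s2 /D !natrM; field.
have w_int : w \in Aint by apply: Aint_sqrt; rewrite w2 rpred_nat.
have ww : (1 + w) * (w - 1) = 1.
  have -> : (1 + w) * (w - 1) = w ^+ 2 - 1 by ring.
  by rewrite w2; ring.
have uw0 : 1 + w != 0.
  by apply/eqP=> h; move/eqP: ww; rewrite h mul0r eq_sym oner_eq0.
have uw : algunit (1 + w).
  split=> //; first by rewrite rpredD // Aint1.
  have -> : (1 + w)^-1 = w - 1 by apply: (mulfI uw0); rewrite mulfV.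
  by rewrite rpredB // Aint1.
have Qw : 1 + w = ratr 1 + ratr (p%:R)^-1 * s.
  by rewrite rmorph1 fmorphV rmorph_nat /w mulrC.
have [|k hk] := gen (1 + w); first by apply/unitOE; split=> //; exists 1, (p%:R)^-1.
have [u [v]] : S (1 + w) by case: hk => ->; [|apply: SN]; exact: SXz.
rewrite Qw -(ratr_int algC u) -(ratr_int algC v) => /(@quadratic_inj D _ _ _ _ ND)[_ ev].
have pq0 : (p%:R : rat) != 0 by rewrite pnatr_eq0 -lt0n prime_gt0.
have pv : p%:Z * v = 1.
  by apply: (@intr_inj rat); rewrite intrM -ev -pmulrn mulfV.
have := congr1 absz pv; rewrite abszM => /eqP; rewrite muln_eq1 => /andP[/eqP /= p_1 _].
by rewrite p_1 in p_pr.
Qed.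

(** * The four norm patterns for d1 = p1 and d2 = 2 p2 *)

Theorem theorem1 (p1 p2 : nat) (eps1 eps2 eps3 : algC) (x y : int) :
  prime p1 -> prime p2 -> (p1 %% 4 = 1)%N -> (p2 %% 4 = 1)%N ->
  fund_unit p1 eps1 -> fund_unit (2 * p2) eps2 -> fund_unit (2 * p1 * p2) eps3 ->
  eps3 = x%:~R + y%:~R * sqrtC (2 * p1 * p2)%:R ->
  let Kp := inKplus p1 p2 in
  let K := inK p1 p2 in
  (* (1) *)
  (qnorm_is (2 * p2) eps2 (-1) -> qnorm_is (2 * p1 * p2) eps3 (-1) ->
     ((exists s, Kp s /\ s ^+ 2 = eps1 * eps2 * eps3) ->
        exists s, Kp s /\ s ^+ 2 = eps1 * eps2 * eps3 /\
          FSU3 Kp eps1 eps2 s /\ FSU3 K eps1 eps2 s /\ hasse_index K Kp 1)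
     /\
     (~ (exists s, Kp s /\ s ^+ 2 = eps1 * eps2 * eps3) ->
        FSU3 Kp eps1 eps2 eps3 /\
        (exists s, K s /\ s ^+ 2 = 'i * eps1 * eps2 * eps3 /\ FSU3 K eps1 eps2 s) /\
        hasse_index K Kp 2))
  /\
  (* (2) *)
  (qnorm_is (2 * p2) eps2 1 -> qnorm_is (2 * p1 * p2) eps3 (-1) ->
     FSU3 Kp eps1 eps2 eps3 /\
     (exists s, K s /\ s ^+ 2 = 'i * eps2 /\ FSU3 K eps1 s eps3) /\
     hasse_index K Kp 2)
  /\
  (* (3) *)
  (qnorm_is (2 * p1 * p2) eps3 1 -> qnorm_is (2 * p2) eps2 (-1) ->
     ((is_sq_nat ((2 * p1)%:Z * (x + 1)) \/ is_sq_nat ((2 * p1)%:Z * (x - 1))) ->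
        exists s, Kp s /\ s ^+ 2 = eps3 /\
          FSU3 Kp eps1 eps2 s /\ FSU3 K eps1 eps2 s /\ hasse_index K Kp 1)
     /\
     (~ (is_sq_nat ((2 * p1)%:Z * (x + 1)) \/ is_sq_nat ((2 * p1)%:Z * (x - 1))) ->
        FSU3 Kp eps1 eps2 eps3 /\
        (exists s, K s /\ s ^+ 2 = 'i * eps3 /\ FSU3 K eps1 eps2 s) /\
        hasse_index K Kp 2))
  /\
  (* (4) *)
  (qnorm_is (2 * p2) eps2 1 -> qnorm_is (2 * p1 * p2) eps3 1 ->
     ((is_sq_nat ((2 * p1)%:Z * (x + 1)) \/ is_sq_nat ((2 * p1)%:Z * (x - 1))) ->
        exists s t, Kp s /\ s ^+ 2 = eps3 /\ K t /\ t ^+ 2 = 'i * eps2 /\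
          FSU3 Kp eps1 eps2 s /\ FSU3 K eps1 t s /\ hasse_index K Kp 2)
     /\
     (~ (is_sq_nat ((2 * p1)%:Z * (x + 1)) \/ is_sq_nat ((2 * p1)%:Z * (x - 1))) ->
        exists s t, Kp s /\ s ^+ 2 = eps2 * eps3 /\ K t /\ t ^+ 2 = 'i * eps3 /\
          FSU3 Kp eps1 eps2 s /\ FSU3 K eps1 s t /\ hasse_index K Kp 2)).
Proof.
move=> p1_pr p2_pr p1_4 p2_4 F1 F2.
have -> : (2 * p1 * p2 = p1 * (2 * p2))%N by rewrite mulnA (mulnC 2%N).
move=> F3 ex Kp K.
have p1n2 := prime_mod4_odd _ p1_4; have p2n2 := prime_mod4_odd _ p2_4.
have p12 : p1 != p2.
  by apply/eqP=> e; rewrite -e in F3 ex; exact: fund_unit_distinct p1_pr p1_4 F3 ex.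
have odd2 p : prime p -> p != 2%N -> ~~ (2 %| p)%N by move=> p_pr pn2; rewrite dvdn_prime2 // eq_sym.
have two1 := odd2 _ p1_pr p1n2; have two2 := odd2 _ p2_pr p2n2.
have d12 : ~~ (p1 %| p2)%N by rewrite dvdn_prime2.
have p1_2 : ~~ (p1 %| 2)%N by rewrite dvdn_prime2.
have p2_2 : ~~ (p2 %| 2)%N by rewrite dvdn_prime2.
have p1_22 : ~~ (p1 %| 2 * p2)%N by rewrite Euclid_dvdM // negb_or p1_2.
have ndvd1 p : prime p -> ~~ (p %| 1)%N by move=> p_pr; rewrite dvdn1 neq_ltn prime_gt1 ?orbT.
have N1 : nonsq p1 by rewrite -[p1]muln1; apply: nonsq_prime_mul => //; exact: ndvd1.
have Np2 : nonsq p2 by rewrite -[p2]muln1; apply: nonsq_prime_mul => //; exact: ndvd1.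
have N2 : nonsq (2 * p2) by exact: nonsq_prime_mul.
have N12 : nonsq (p1 * (2 * p2)) by exact: nonsq_prime_mul.
(* The three facts on 3 d exclude cube roots of unity from the imaginary quadratic fields Q(sqrt (-
   d)). *)
have T1 : nonsq (3 * p1).
  by apply: nonsq_prime_mul => //; rewrite dvdn_prime2 // eq_sym; exact: prime_mod4_neq3.
have T2 : nonsq (3 * (2 * p2)).
  by rewrite mulnCA; apply: nonsq_prime_mul; rewrite // Euclid_dvdM.
have T12 : nonsq (3 * (p1 * (2 * p2))).
  rewrite (mulnCA p1) (mulnCA 3%N); apply: nonsq_prime_mul => //.
  by rewrite !Euclid_dvdM // !negb_or two1 two2.
have [A1 [A2 [[a11 a12 a1i] [a21 a22 a2i]]]] := biquad_auts _ _ N1 N2 N12.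
have no_sqrt2 f : biquad p1 (2 * p2) f -> f ^+ 2 <> 2.
  move=> Kf ef; have [q] := biquad_sqrt_nat _ _ N1 N2 A1 A2 a11 a12 a21 a22 2 f Kf ef.
  case=> eq.
  - by case/eqP: (nonsq_prime_mul 2 1 isT isT q).
  - case/eqP: (nonsq_prime_mul 2 p1 isT two1 (p1%:R * q)).
    by rewrite natrM -eq; ring.
  - case/eqP: (Np2 (p2%:R * q)); move: eq; rewrite natrM => eq.
    have {}eq : p2%:R * q ^+ 2 = 1 by lra.
    by rewrite exprMn expr2 -mulrA eq mulr1.
  case/eqP: (nonsq_prime_mul p1 p2 p1_pr d12 ((p1 * p2)%:R * q)).
  have {}eq : (p1 * p2)%:R * q ^+ 2 = 1 by move: eq; rewrite !natrM => eq; lra.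
  by rewrite exprMn expr2 -mulrA eq mulr1.
have sq_class u n : algunit u -> (0 < n)%N -> is_sq p1 (2 * p2) (n%:R * u) ->
    is_sq p1 (2 * p2) u \/ is_sq p1 (2 * p2) (2 * u).
  move=> uu n_gt0 sq; rewrite -[X in is_sq _ _ X \/ _]mul1r.
  have p2_gt2 : (2 < p2)%N by rewrite ltn_neqAle eq_sym p2n2 prime_gt1.
  apply: (descent_two (fun n => is_sq p1 (2 * p2) (n%:R * u)) _ p1 p2 p1_pr p2_pr p2_gt2 _ _ _ n) => //.
  - by move=> *; apply: (is_sq_mul_sqr _ _ N1 N2 N12 u); eassumption.
  - by move=> *; apply: is_sq_mul1.
  - by move=> *; apply: is_sq_mul2.
  - by move=> q m *; apply: (is_sq_ram _ _ N1 N2 N12 u uu).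
have en1 : eps1 * A1 eps1 = -1.
  by rewrite (qnorm_aut A1 p1 _ (-1) a11) ?rmorphN1 //; exact: fund_unit_prime_norm.
have norm2 n : qnorm_is (2 * p2) eps2 n -> eps2 * A2 eps2 = ratr n by exact: qnorm_aut.
have norm3 n : qnorm_is (p1 * (2 * p2)) eps3 n -> eps3 * A1 eps3 = ratr n.
  by apply: qnorm_aut; rewrite sqrtCM12 rmorphM /= a11 a12 mulNr.
have [/unitOE[_ u1] _] := F1; have [/unitOE[_ u2] _] := F2; have [/unitOE[_ u3] _] := F3.
(* Otherwise p1 eps2 = g^2 in Q(sqrt (2 p2)). Viewed inside Q(sqrt (2 p2), sqrt 2), where p1 is
   unramified, this forces p1^2 to divide p1. *)
have nsq2 : ~ is_sq p1 (2 * p2) eps2.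
  case/(is_sq_e2 _ _ A1 a11 a12 _ F2)=> g [Qg eg].
  have M1 : nonsq 2 by apply: (nonsq_prime_mul 2 1).
  have M2 : nonsq (2 * p2 * 2).
    rewrite mulnAC mulnC; apply: nonsq_prime_mul => //.
    by rewrite Euclid_dvdM // orbb.
  have [B1 [B2 [[b11 b12 b1i] [b21 b22 b2i]]]] := biquad_auts _ _ N2 M1 M2.
  have : (p1 ^ 2 %| p1)%N.
    apply: (unramified_dvd _ _ B1 B2 b11 b12 b21 b22 p1 p1 eps2 g) => //.
      by rewrite !Euclid_dvdM // !negb_or p1_2 d12.
    exact: inQsqrt_biquad1.
  move/dvdn_leq; rewrite prime_gt0 // => /(_ isT).
  by rewrite leqNgt ltn_Pmulr ?prime_gt0 ?prime_gt1.
have sq2 : eps2 * A2 eps2 = 1 -> is_sq p1 (2 * p2) (2 * eps2).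
  move=> h; have [n [n_gt0 sq]] := sqclass2 _ _ A1 A2 a11 a12 a21 a22 _ _ F2 erefl h.
  by case: (sq_class _ _ u2 n_gt0 sq).
have sq3 : eps3 * A1 eps3 = 1 -> is_sq p1 (2 * p2) eps3 \/ is_sq p1 (2 * p2) (2 * eps3).
  move=> h; have [n [n_gt0 sq]] := sqclass3 _ _ A1 A2 a11 a12 a21 a22 _ _ F3 erefl h.
  exact: sq_class u3 n_gt0 sq.
have crit h := is_sq_e3 _ _ N12 A1 A2 a11 a12 a21 a22 _ _ F3 erefl x y ex h.
have crit_conv h := is_sq_e3_conv _ _ N1 A1 A2 a11 a12 a21 a22 _ _ F3 erefl x y ex h.
split; [|split; [|split]].
- move=> /norm2 h2 /norm3 h3; rewrite rmorphN1 in h2 h3.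
  apply: (units_case1 _ _ N1 N2 N12 A1 A2 a11 a12 a1i a21 a22 a2i no_sqrt2 T1 T2 T12
    _ _ _ _ _ _ F1 F2 F3 en1 h2 h3) => //.
  have [n [n_gt0 sq]] := sqclass123 _ _ A1 A2 a11 a12 a21 a22 _ _ _ _ _ _ F1 F2 F3 en1 h2 h3 erefl erefl erefl.
  by apply: sq_class n_gt0 sq; do 2?apply: algunitM.
- move=> /norm2 h2 /norm3 h3; rewrite rmorphN1 in h3; rewrite rmorph1 in h2.
  apply: (units_case2 _ _ N1 N2 N12 A1 A2 a11 a12 a1i a21 a22 a2i no_sqrt2 T1 T2 T12
    _ _ _ _ _ _ F1 F2 F3 en1 h2 h3) => //; exact: sq2.
- move=> /norm3 h3 /norm2 h2; rewrite rmorphN1 in h2; rewrite rmorph1 in h3.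
  have [c1 c2] := units_case3 _ _ N1 N2 N12 A1 A2 a11 a12 a1i a21 a22 a2i no_sqrt2 T1 T2 T12
    _ _ _ _ _ _ F1 F2 F3 en1 h2 h3 erefl erefl erefl.
  split=> [/(crit_conv h3)/c1 //|nsq].
  have nsq3 : ~ is_sq p1 (2 * p2) eps3 by move/(crit h3).
  by apply: c2 => //; case: (sq3 h3).
move=> /norm2 h2 /norm3 h3; rewrite rmorph1 in h2 h3.
have [c1 c2] := units_case4 _ _ N1 N2 N12 A1 A2 a11 a12 a1i a21 a22 a2i no_sqrt2 T1 T2 T12
  _ _ _ _ _ _ F1 F2 F3 en1 h2 h3 erefl erefl erefl nsq2 (sq2 h2).
split=> [/(crit_conv h3)/c1 //|nsq].
have nsq3 : ~ is_sq p1 (2 * p2) eps3 by move/(crit h3).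
by apply: c2 => //; case: (sq3 h3).
Qed.
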